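(* Let $n\ge 6$ be an integer, and call an $n$-vertex graph extremal for $P^2_6$ if it contains no subgraph isomorphic to $P^2_6$ and has exactly $\mathrm{ex}(n,P^2_6)$ edges. Up to isomorphism, the extremal graphs for $P^2_6$ are exactly the following: if $n\equiv 1\pmod 6$: the graphs $F^{\lceil n/2\rceil,j}_n$ and $H^{\lfloor n/2\rfloor}_n$; if $n\equiv 2\pmod 6$: the graphs $F^{n/2,j}_n$ and $F^{n/2+1,j}_n$; if $n\equiv 3\pmod 6$: the graphs $F^{\lceil n/2\rceil,j}_n$ and $H^{\lceil n/2\rceil+1}_n$; if $n\equiv 0\pmod 6$: $H^{n/2}_n$; if $n\equiv 4\pmod 6$: $H^{n/2+1}_n$; if $n\equiv 5\pmod 6$: $H^{\lceil n/2\rceil}_n$. Here, in each $F^{i,j}_n$, $j$ ranges over all integers with $1\le j\le i$ and $3\mid (i-j)$.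
   Context: All graphs are finite, simple and undirected. $P^2_k$ is the square of the path on $k$ vertices $v_1,\dots,v_k$: $v_i,v_j$ adjacent iff $1\le |i-j|\le 2$. $\mathrm{ex}(n,H)$ is the maximum number of edges in an $n$-vertex graph not containing $H$ as a subgraph. For $1\le i\le n-1$ consider $K_{i,n-i}$ with classes $X$, $|X|=i$, and $Y$, $|Y|=n-i$. For $1\le j\le i$ with $3\mid(i-j)$, $F^{i,j}_n$ is obtained by adding inside $X$ a vertex-disjoint union of $(i-j)/3$ triangles and one star on the remaining $j$ vertices of $X$ (a center joined to the other $j-1$ vertices; for $j=1$ this is a single vertex and nothing is added). For $3\mid i$, $H^i_n$ is obtained by adding inside $X$ a vertex-disjoint union of $i/3$ triangles covering $X$. No edges are added inside $Y$. *)

(* Defs.v *)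
(* MathComp world *)
From HB Require Import structures.
From mathcomp Require Import all_boot.

Set Implicit Arguments.
Unset Strict Implicit.
Unset Printing Implicit Defensive.

Record sgraph (T : finType) := SGraph {
  edges : {set {set T}};
  _ : [forall e in edges, #|e| == 2]
}.

HB.instance Definition _ (T : finType) := [isSub for @edges T].
HB.instance Definition _ (T : finType) := [Finite of sgraph T by <:].

Definition adj (T : finType) (G : sgraph T) : rel T :=
  fun x y => [set x; y] \in edges G.

(* [r] need not be symmetric or irreflexive: an edge joins two distinct
   vertices related by [r] in at least one direction. *)
Definition edges_of_rel (T : finType) (r : rel T) : {set {set T}} :=
  [set [set x; y] | x in T, y in T & (x != y) && r x y].

Fact edges_of_relP (T : finType) (r : rel T) :
  [forall e in edges_of_rel r, #|e| == 2].
Proof.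
apply/forall_inP => e /imset2P [x y _]; rewrite inE => /and3P [_ nxy _] ->.
by rewrite cards2 nxy.
Qed.

Definition graph_of_rel (T : finType) (r : rel T) : sgraph T :=
  SGraph (edges_of_relP r).

(* Not necessarily induced. *)
Definition has_subgraph (U T : finType) (H : sgraph U) (G : sgraph T) : bool :=
  [exists f : {ffun U -> T},
    injectiveb f && [forall x, forall y, adj H x y ==> adj G (f x) (f y)]].

Definition isomorphic (T U : finType) (G : sgraph T) (H : sgraph U) : Prop :=
  exists2 f : T -> U, bijective f & forall x y, adj H (f x) (f y) = adj G x y.

Definition turan_number (n : nat) (U : finType) (H : sgraph U) : nat :=
  \max_(G : sgraph 'I_n | ~~ has_subgraph H G) #|edges G|.

Definition extremal (U T : finType) (H : sgraph U) (G : sgraph T) : Prop :=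
  ~~ has_subgraph H G /\ #|edges G| = turan_number #|T| H.

Definition square_path (k : nat) : sgraph 'I_k :=
  graph_of_rel (fun x y : 'I_k => x < y <= x + 2).

(* In the two constructions below, X = {0, ..., i-1} and Y = {i, ..., n-1}. *)

Definition bipartite_rel (i : nat) : rel nat := fun x y => x < i <= y.

(* The triangles {j+3m, j+3m+1, j+3m+2} tiling {j, ..., i-1}, when 3 divides
   i - j. *)
Definition triangles_rel (j i : nat) : rel nat := fun x y =>
  [&& j <= x < i, j <= y < i & (x - j) %/ 3 == (y - j) %/ 3].

(* The star on {0, ..., j-1} with center 0. *)
Definition star_rel (j : nat) : rel nat := fun x y => (x == 0) && (y < j).

(* Meaningful for 1 <= i <= n-1, 1 <= j <= i and 3 %| i - j. *)
Definition F_graph (n i j : nat) : sgraph 'I_n :=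
  graph_of_rel (fun x y : 'I_n =>
    [|| bipartite_rel i x y, triangles_rel j i x y | star_rel j x y]).

(* Meaningful for 1 <= i <= n-1 and 3 %| i. *)
Definition H_graph (n i : nat) : sgraph 'I_n :=
  graph_of_rel (fun x y : 'I_n => bipartite_rel i x y || triangles_rel 0 i x y).

Definition isomorphic_to_some_F (n i : nat) (T : finType) (G : sgraph T) : Prop :=
  exists j : nat,
    [/\ 1 <= j <= i, 3 %| i - j & isomorphic G (F_graph n i j)].

(* Main.v *)
Require Import Defs.
From mathcomp Require Import all_boot.
From mathcomp Require Import zify.

(* Let f(n) be the claimed extremal number.

   If G has no K_4 and every edge lay in two triangles, the link of a vertex
   would contain a path on four vertices that extends to a squared path; so some
   edge xy lies in at most one triangle, and deleting x and y costs at most n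
   edges. Equality at each step forces a vertex joined to a balanced complete
   bipartite graph.

   If G has a K_4 but no K_5, let A be a triangle and Y the (independent) set of
   its common neighbours. When |Y| >= 3, delete A and three vertices of Y: these
   span 12 edges and every other vertex sends at most 3 edges to them, while
   f(n) - f(n - 6) = 3n - 6. In case of equality every vertex outside Y is either
   in A or adjacent to all three deleted vertices of Y and to none of A, so that
   the complement X of Y contains no path on four vertices. When |Y| = 2 for some
   A, or |Y| <= 1 for all A, deleting A and Y, or a K_4, is strictly cheaper.
   A K_5 receives at most one edge from each other vertex and is cheaper still.

   So an extremal graph is a join of an independent set with a set X without P_4,
   whose components are then triangles and stars; at most one star can occur by
   counting, and comparing i (n - i) + i with f(n) leaves the listed sizes i. *)

Set Implicit Arguments.
Unset Strict Implicit.
Unset Printing Implicit Defensive.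

(* The edge number of the extremal graphs for n >= 6; for smaller n it is the
   maximum among K_5-free graphs. *)
Definition exval (n : nat) : nat :=
  9 * (n %/ 6) ^ 2 + 3 * (n %% 6).+1 * (n %/ 6)
  + nth 0 [:: 0; 0; 1; 3; 6; 9] (n %% 6).

Lemma exvalE k r : r < 6 ->
  exval (6 * k + r) =
  9 * (k * k) + 3 * r.+1 * k + nth 0 [:: 0; 0; 1; 3; 6; 9] r.
Proof.
move=> lt_r6; have -> : 6 * k + r = k * 6 + r by lia.
by rewrite /exval divnMDl // modnMDl divn_small // modn_small // addn0 mulnn.
Qed.

Variant mod6_spec : nat -> Type :=
  Mod6 k r of r < 6 : mod6_spec (6 * k + r).

Lemma mod6P n : mod6_spec n.
Proof. by rewrite (divn_eq n 6) mulnC; apply: Mod6; rewrite ltn_mod. Qed.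

Lemma exvalD6 n : exval (6 + n) = exval n + 3 * n + 12.
Proof.
case: (mod6P n) => k r lt_r6.
by rewrite addnA -mulnS !exvalE //; lia.
Qed.

Lemma nat_ind6 (P : nat -> Prop) :
  P 0 -> P 1 -> P 2 -> P 3 -> P 4 -> P 5 -> (forall n, P n -> P (6 + n)) ->
  forall n, P n.
Proof.
move=> P0 P1 P2 P3 P4 P5 PS; elim/ltn_ind.
by do 6! [case=> [|] //]; move=> n IHn; apply/PS/IHn; lia.
Qed.

Lemma exvalD4 n : exval n + 2 * n + 5 <= exval (4 + n).
Proof.
by elim/nat_ind6: n => // n IHn; rewrite addnCA !exvalD6; lia.
Qed.

Lemma exvalD5 n : 0 < n -> exval n + 2 * n + 10 <= exval (5 + n).
Proof.
elim/nat_ind6: n => // n IHn _.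
case: (posnP n) => [-> // | n_gt0]; move: (IHn n_gt0).
by rewrite addnCA !exvalD6; lia.
Qed.

Lemma exval_ge3n n : 3 * n + 8 <= exval (5 + n).
Proof.
by elim/nat_ind6: n => // n IHn; rewrite addnCA exvalD6; lia.
Qed.

(* The edge number of the join of a vertex with a balanced complete bipartite
   graph on n - 1 vertices. *)
Definition kval (n : nat) : nat := n.-1 + n.-1./2 * uphalf n.-1.

Lemma kvalD2 n : 0 < n -> kval (2 + n) = kval n + n + 2.
Proof.
by case: n => // n _; rewrite /kval /=; lia.
Qed.

Lemma kval_le_exval n : kval n <= exval n.
Proof.
elim/nat_ind6: n => // n IHn; rewrite exvalD6.
case: (posnP n) => [-> //|n_gt0].
by rewrite (kvalD2 (n := 4 + n)) // (kvalD2 (n := 2 + n)) // (kvalD2 n_gt0);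
  lia.
Qed.

Section Arcs.

Variables (T : finType) (e : rel T).

(* Ordered pairs: arcs S S is twice the number of edges inside S. *)
Definition arcs (S D : {set T}) : nat := \sum_(x in S) \sum_(y in D) e x y.

Definition arcs_seq (s : seq T) : nat := \sum_(x <- s) \sum_(y <- s) e x y.

Hypothesis esym : symmetric e.

Lemma arcsC (S D : {set T}) : arcs S D = arcs D S.
Proof.
rewrite /arcs exchange_big; apply: eq_bigr => x _; apply: eq_bigr => y _.
by rewrite esym.
Qed.

Lemma arcs_splitl (S S' D : {set T}) : D \subset S -> arcs S S' = arcs D S' +
  arcs (S :\: D) S'.
Proof. by move=> sDS; rewrite /arcs (big_setID D) /= (setIidPr sDS). Qed.

Lemma arcs_split (S D : {set T}) : D \subset S ->
  arcs S S = arcs D D + 2 * arcs (S :\: D) D + arcs (S :\: D) (S :\: D).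
Proof.
move=> sDS; rewrite (arcs_splitl _ sDS) arcsC (arcs_splitl _ sDS).
by rewrite (arcsC (S :\: D) S) (arcs_splitl _ sDS) (arcsC D); lia.
Qed.

Lemma sum_seq_set (s : seq T) (F : T -> nat) :
  uniq s -> \sum_(x in [set x in s]) F x = \sum_(x <- s) F x.
Proof. by move=> Us; rewrite (eq_bigl (mem s)) ?big_uniq // => x;
  rewrite inE. Qed.

Lemma arcs_set_seq (s : seq T) : uniq s -> arcs [set x in s] [set x in s] =
  arcs_seq s.
Proof.
move=> Us; rewrite /arcs sum_seq_set //; apply: eq_bigr => x _.
exact: sum_seq_set.
Qed.

Lemma cards_setD_seq (S : {set T}) (s : seq T) :
  uniq s -> {subset s <= S} -> #|S :\: [set x in s]| + size s = #|S|.
Proof.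
move=> Us sS; rewrite -(card_uniqP Us) addnC -(cardsID [set x in s] S).
by congr (_ + _); apply: eq_card => x; rewrite !inE andbC;
  case: (boolP (x \in s)) => // /sS ->.
Qed.

Lemma arcs_del (S : {set T}) (s : seq T) : uniq s -> {subset s <= S} ->
  arcs S S = arcs_seq s
    + 2 * \sum_(v in S :\: [set x in s]) \sum_(y <- s) e v y
    + arcs (S :\: [set x in s]) (S :\: [set x in s]).
Proof.
move=> Us sS; rewrite (@arcs_split _ [set x in s]); last first.
  by apply/subsetP => x; rewrite inE => /sS.
rewrite arcs_set_seq //; congr (_ + 2 * _ + _).
by apply: eq_bigr => x _; apply: sum_seq_set.
Qed.

End Arcs.

Lemma sum_leq_card (T : finType) (D : {set T}) (F : T -> nat) c :
  (forall x, x \in D -> F x <= c) -> \sum_(x in D) F x <= c * #|D|.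
Proof. by move=> leF; rewrite mulnC -sum_nat_const; apply: leq_sum. Qed.

Lemma sum_eq_card (T : finType) (D : {set T}) (F : T -> nat) c :
  (forall x, x \in D -> F x <= c) -> c * #|D| <= \sum_(x in D) F x ->
  forall x, x \in D -> F x = c.
Proof.
move=> leF; rewrite mulnC -sum_nat_const => geF x Dx.
apply/eqP; move: x Dx; apply/forall_inP.
rewrite -(leqif_sum (fun x Dx => leqif_eq (leF x Dx))) eqn_leq geF andbT.
exact: leq_sum.
Qed.

Definition P6sq_free (T : finType) (e : rel T) : Prop :=
  forall v1 v2 v3 v4 v5 v6 : T, uniq [:: v1; v2; v3; v4; v5; v6] ->
  ~~ [&& e v1 v2, e v1 v3, e v2 v3, e v2 v4, e v3 v4, e v3 v5, e v4 v5,
         e v4 v6 & e v5 v6].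

Section LightEdges.

Variables (T : finType) (e : rel T).
Hypotheses (esym : symmetric e) (eirr : irreflexive e).

Lemma edge_neq x y : e x y -> x != y.
Proof. by apply: contraTneq => ->; rewrite eirr. Qed.

Hypothesis P6free : P6sq_free e.

Lemma noP6sq v1 v2 v3 v4 v5 v6 :
  e v1 v2 -> e v1 v3 -> e v2 v3 -> e v2 v4 -> e v3 v4 -> e v3 v5 -> e v4 v5 ->
  e v4 v6 -> e v5 v6 ->
  [&& v1 != v4, v1 != v5, v1 != v6, v2 != v5, v2 != v6 & v3 != v6] -> False.
Proof.
move=> e12 e13 e23 e24 e34 e35 e45 e46 e56 /and5P[n14 n15 n16 n25 /andP[n26
  n36]].
suff /P6free : uniq [:: v1; v2; v3; v4; v5; v6].
  by rewrite e12 e13 e23 e24 e34 e35 e45 e46 e56.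
rewrite /= !inE !negb_or n14 n15 n16 n25 n26 n36.
by rewrite (edge_neq e12) (edge_neq e13) (edge_neq e23) (edge_neq e24)
  (edge_neq e34) (edge_neq e35) (edge_neq e45) (edge_neq e46) (edge_neq e56).
Qed.

Definition K4_free (S : {set T}) : Prop :=
  forall a b c d, a \in S -> b \in S -> c \in S -> d \in S ->
  e a b -> e a c -> e a d -> e b c -> e b d -> e c d -> False.

(* If every edge lay in two triangles of S, the link of a vertex x would be
   triangle-free of minimum degree 2, hence contain a path a y a' b; a second
   common neighbour of a' and b then completes a squared path. *)
Lemma exists_light_edge (S : {set T}) x y : K4_free S ->
  x \in S -> y \in S -> e x y ->
  exists x' y', [/\ x' \in S, y' \in S, e x' y' &
    forall z z', z \in S -> z' \in S -> e z x' -> e z y' -> e z' x' -> e z' y'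
      ->
    z = z'].
Proof.
move=> K4S Sx Sy exy.
have [/exists_inP[x' Sx' /exists_inP[y' Sy' /andP[exy' H]]]|light] := boolP
  [exists x' in S, exists y' in S, e x' y' && [forall z in S, forall z' in S,
    [&& e z x', e z y', e z' x' & e z' y'] ==> (z == z')]].
  exists x', y'; split=> // z z' Sz Sz' zx zy z'x z'y; apply/eqP.
  have /forall_inP/(_ _ Sz') := forall_inP H z Sz.
  by rewrite zx zy z'x z'y.
have heavy x' y' w : x' \in S -> y' \in S -> e x' y' ->
    exists z, [/\ z \in S, e z x', e z y' & z != w].
  move=> Sx' Sy' exy'.
  have /exists_inPn/(_ _ Sx') /exists_inPn/(_ _ Sy') := light.
  rewrite exy' /= => /forall_inPn[z Sz] /forall_inPn[z' Sz'].
  rewrite negb_imply => /andP[/and4P[zx zy z'x z'y] zz'].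
  by have [zw|zw] := eqVneq z w; [exists z'; rewrite -zw eq_sym | exists z].
have [a [Sa ax ay _]] := heavy x y x Sx Sy exy.
have [a' [Sa' a'x a'y a'a]] := heavy x y a Sx Sy exy.
have xa' : e x a' by rewrite esym.
have [b [Sb bx ba' bny]] := heavy x a' y Sx Sa' xa'.
have [v [Sv va' vb vnx]] := heavy a' b x Sa' Sb (etrans (esym _ _) ba').
have K4 := K4S x.
exfalso; apply: (@noP6sq a y x a' b v) => //; try by rewrite esym.
rewrite (eq_sym a) a'a (eq_sym y) bny (eq_sym x) vnx andbT /=.
apply/and3P; split.
- by apply/eqP=> ab; apply: (K4 y a a'); rewrite ?ab // esym // -ab.
- by apply/eqP=> av; apply: (K4 y a a'); rewrite ?av // esym // -av.
- by apply/eqP=> yv; apply: (K4 y a' b) => //; rewrite ?yv // esym // -yv esym.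
Qed.

(* S induces the join of the apex c with a balanced complete bipartite graph.
   Balance is only needed to exclude stars, where the apex is ambiguous. *)
Definition cone (S : {set T}) (c : T) (A B : {set T}) : Prop :=
  [/\ S = c |: (A :|: B), c \notin A :|: B, [disjoint A & B],
      #|A| <= #|B|.+1 /\ #|B| <= #|A|.+1 &
      [/\ {in A :|: B, forall x, e c x}, {in A & B, forall x y, e x y},
          {in A &, forall x y, ~~ e x y} & {in B &, forall x y, ~~ e x y}]].

Lemma cone_sym S c A B : cone S c A B -> cone S c B A.
Proof.
case=> -> cAB dAB [leAB leBA] [cadj AB A0 B0]; rewrite setUC in cAB cadj *.
split=> //; rewrite 1?disjoint_sym ?(setUC A) //.
split=> // x y Bx Ay; by rewrite esym AB.
Qed.

Definition light (S : {set T}) (x y z : T) : Prop :=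
  [/\ x \in S, y \in S, e x y & [/\ z \in S, e z x, e z y &
    forall v, v \in S -> v != x -> v != y -> v != z -> e v x = ~~ e v y]].

Lemma light_sym S x y z : light S x y z -> light S y x z.
Proof.
case=> Sx Sy exy [Sz zx zy H]; split=> //; first by rewrite esym.
by split=> // v Sv vy vx vz; rewrite H ?negbK.
Qed.

Lemma cone_center S x y c A B : light S x y c -> cone (S :\ x :\ y) c A B ->
  {in A, forall a, ~~ e a x} -> {in B, forall b, ~~ e b y} ->
  cone S c (x |: A) (y |: B).
Proof.
case=> Sx Sy exy [Sc cx cy H] [DS cAB dAB [leAB leBA] [cadj AB A0 B0]] Ax By.
have xNR : x \notin c |: (A :|: B) by rewrite -DS !inE eqxx andbF.
have yNR : y \notin c |: (A :|: B) by rewrite -DS !inE eqxx.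
have [xA yB] : x \notin A /\ y \notin B.
  by split; [move: xNR | move: yNR]; apply: contra; rewrite !inE => ->;
    rewrite ?orbT.
have adjx b : b \in B -> e x b.
  move=> Bb; have Rb : b \in S :\ x :\ y by rewrite DS !inE Bb !orbT.
  rewrite esym H ?By //; move: Rb; rewrite !inE; try by case/and3P.
  by move=> _; apply: contraNneq cAB => <-; rewrite inE Bb orbT.
have adjy a : a \in A -> e a y.
  move=> Aa; have Ra : a \in S :\ x :\ y by rewrite DS !inE Aa !orbT.
  have := Ax a Aa; rewrite H ?negbK //; move: Ra; rewrite !inE;
    try by case/and3P.
  by move=> _; apply: contraNneq cAB => <-; rewrite inE Aa.
split.
- rewrite -(setD1K Sx) -(setD1K (_ : y \in S :\ x)) ?DS.
    by apply/setP=> v; rewrite !inE; do !case: (_ == _) => //=; rewrite ?orbT.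
  by rewrite !inE Sy eq_sym edge_neq.
- move: xNR yNR cAB; rewrite !inE ![c == _]eq_sym !negb_or.
  by case/andP=> -> _ /andP[-> _] /andP[-> ->].
- rewrite -setI_eq0; apply/eqP/setP=> v; rewrite !inE.
  have /pred0P/(_ v)/= dv := dAB.
  apply/negP=> /andP[/predU1P[->|Av] /predU1P[Dv|Bv]].
  + by rewrite Dv eirr in exy.
  + by rewrite !inE Bv !orbT in xNR.
  + by rewrite !inE -Dv Av !orbT in yNR.
  + by rewrite Av Bv in dv.
- by rewrite !cardsU1 xA yB !add1n !ltnS.
- split.
  + move=> v; rewrite !inE -orbA => /or4P[/eqP->|Av|/eqP->|Bv] //.
      by apply: cadj; rewrite inE Av.
    by apply: cadj; rewrite inE Bv orbT.
  + move=> u v; rewrite !inE => /predU1P[->|Au] /predU1P[->|Bv] //;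
      [exact: adjx | exact: adjy | exact: AB].
  + move=> u v; rewrite !inE => /predU1P[->|Au] /predU1P[->|Av] //;
      by [rewrite eirr | rewrite esym Ax | rewrite Ax | apply: A0].
  + move=> u v; rewrite !inE => /predU1P[->|Au] /predU1P[->|Av] //;
      by [rewrite eirr | rewrite esym By | rewrite By | apply: B0].
Qed.

(* A second vertex a of A would give a squared path y x z c b a, so A = {z} and
   z takes over the role of the apex. *)
Lemma cone_side S x y z c A B : K4_free S -> light S x y z ->
  cone (S :\ x :\ y) c A B -> z \in A -> e c x ->
  cone S z [set c; y] (x |: B).
Proof.
move=> K4S [Sx Sy exy [Sz zx zy H]] [DS cAB dAB [leAB leBA] [cadj AB A0 B0]] Az
  cx.
have xNR : x \notin c |: (A :|: B) by rewrite -DS !inE eqxx andbF.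
have yNR : y \notin c |: (A :|: B) by rewrite -DS !inE eqxx.
have R_ v : v \in c |: (A :|: B) -> [/\ v \in S, v != x & v != y].
  by rewrite -DS !inE => /and3P[].
have [Sc cnx cny] : [/\ c \in S, c != x & c != y] by apply: R_;
  rewrite !inE eqxx.
have cz : e c z by apply: cadj; rewrite inE Az.
have cNy : ~~ e c y by rewrite -H ?cx // edge_neq.
have Bfacts b : b \in B -> [/\ b \in S, b != x, b != y, e c b & e z b].
  move=> Bb; have [|Sb bx by_] := R_ b; first by rewrite !inE Bb !orbT.
  by split=> //; [apply: cadj; rewrite inE Bb orbT | apply: AB].
have Bx b : b \in B -> ~~ e b x.
  move=> Bb; have [Sb bx by_ cb zb] := Bfacts b Bb.
  by apply/negP=> ebx; apply: (K4S x c z b) => //; rewrite esym.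
have By b : b \in B -> e b y.
  move=> Bb; have [Sb bx by_ cb zb] := Bfacts b Bb.
  by have := Bx b Bb; rewrite H ?negbK //; rewrite eq_sym edge_neq.
have A1 : A = [set z].
  apply/eqP; rewrite eqEsubset sub1set Az andbT; apply/subsetP=> a2 Aa2.
  rewrite inE; apply/eqP; apply: contraTeq leAB => a2z.
  suff B_0 : B = set0.
    rewrite B_0 cards0 -ltnNge.
    apply: (@leq_trans #|[set z; a2]|); first by rewrite cards2 eq_sym a2z.
    apply/subset_leq_card/subsetP=> v; rewrite !inE.
    by case/orP=> /eqP->.
  apply/setP=> b; rewrite inE; apply/negP=> Bb.
  have [Sb bx by_ cb zb] := Bfacts b Bb.
  have [|Sa2 a2x a2y] := R_ a2; first by rewrite !inE Aa2 orbT.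
  apply: (@noP6sq y x z c b a2) => //; try by rewrite esym.
  - by apply: cadj; rewrite inE Aa2.
  - by rewrite esym AB.
  by rewrite ![y == _]eq_sym cny by_ a2y ![x == _]eq_sym bx a2x eq_sym a2z.
have [zc zny znx] : [/\ z != c, z != y & z != x].
  by rewrite (edge_neq zx) (edge_neq zy) eq_sym (edge_neq cz).
split.
- rewrite -(setD1K Sx) -(setD1K (_ : y \in S :\ x)) ?DS ?A1.
    by apply/setP=> v; rewrite !inE; do !case: (_ == _) => //=.
  by rewrite !inE Sy eq_sym edge_neq.
- rewrite !inE (negPf zc) (negPf zny) (negPf znx) /=.
  by have /pred0P/(_ z)/= := dAB; rewrite Az /= => ->.
- rewrite -setI_eq0; apply/eqP/setP=> v; rewrite !inE.
  apply/negP=> /andP[/orP[]/eqP-> /predU1P[Dv|Bv]].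
  + by rewrite Dv eqxx in cnx.
  + by rewrite !inE Bv orbT in cAB.
  + by rewrite Dv eirr in exy.
  + by rewrite !inE Bv !orbT in yNR.
- rewrite cards2 cny cardsU1; have -> : x \notin B.
    by move: xNR; apply: contra; rewrite !inE => ->; rewrite !orbT.
  by move: leBA; rewrite A1 cards1 /= add1n; move: #|B|; clear; lia.
- split.
  + move=> v; rewrite !inE -!orbA => /or4P[/eqP->|/eqP->|/eqP->|/Bfacts[]] //.
    by rewrite esym.
  + move=> u v; rewrite !inE => /orP[]/eqP-> /predU1P[->|Bv] //.
    * by have [] := Bfacts v Bv.
    * by rewrite esym.
    * by rewrite esym By.
  + move=> u v; rewrite !inE => /orP[]/eqP-> /orP[]/eqP->;
    by rewrite ?eirr // esym.
  + move=> u v; rewrite !inE => /predU1P[->|Bu] /predU1P[->|Bv];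
    by [rewrite eirr | rewrite esym Bx | rewrite Bx | apply: B0].
Qed.

End LightEdges.

Section K4Free.

Variables (T : finType) (e : rel T).
Hypotheses (esym : symmetric e) (eirr : irreflexive e).
Hypothesis P6free : P6sq_free e.

Lemma cone_step S x y z c A B : K4_free e S -> light e S x y z ->
  cone e (S :\ x :\ y) c A B -> exists c' A' B', cone e S c' A' B'.
Proof.
move=> K4S L C.
have Cs := cone_sym esym C; have Ls := light_sym esym L.
have Cxy : cone e (S :\ y :\ x) c A B.
  by congr cone: C; apply/setP=> v; rewrite !inE andbCA.
have Csxy := cone_sym esym Cxy.
have [Sx Sy exy [Sz zx zy H]] := L.
have [DS cAB dAB [leAB leBA] [cadj AB A0 B0]] := C.
have R_ v : v \in c |: (A :|: B) -> [/\ v \in S, v != x & v != y].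
  by rewrite -DS !inE => /and3P[].
have [Sc cnx cny] : [/\ c \in S, c != x & c != y] by apply: R_;
  rewrite !inE eqxx.
have : z \in c |: (A :|: B) by rewrite -DS !inE Sz (edge_neq eirr zx) (edge_neq
  eirr zy).
rewrite !inE => /or3P[/eqP Dz|Az|Bz]; first last.
- have ecz : e c z by apply: cadj; rewrite inE Bz orbT.
  case cx: (e c x).
    by do 3!eexists; apply: cone_side K4S L Cs Bz cx.
  have cy : e c y by rewrite -[e c y]negbK -H ?cx ?(edge_neq eirr ecz).
  by do 3!eexists; apply: cone_side K4S Ls Csxy Bz cy.
- have ecz : e c z by apply: cadj; rewrite inE Az.
  case cx: (e c x).
    by do 3!eexists; apply: cone_side K4S L C Az cx.
  have cy : e c y by rewrite -[e c y]negbK -H ?cx ?(edge_neq eirr ecz).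
  by do 3!eexists; apply: cone_side K4S Ls Cxy Az cy.
rewrite {z Sz}Dz in zx zy H L Ls.
have one w : w \in S -> e c w -> (forall a b, a \in A -> b \in B -> e a w -> ~~
  e b w).
  move=> Sw cw a b Aa Bb aw; apply/negP=> bw.
  have [|Sa _ _] := R_ a; first by rewrite !inE Aa orbT.
  have [|Sb _ _] := R_ b; first by rewrite !inE Bb !orbT.
  apply: (K4S c a b w) => //; last exact: AB.
    by apply: cadj; rewrite inE Aa.
  by apply: cadj; rewrite inE Bb orbT.
have xorR v : v \in A :|: B -> e v x = ~~ e v y.
  move=> ABv; have [|Sv vx vy] := R_ v; first by rewrite in_setU1 ABv orbT.
  by apply: H => //; apply: contraNneq cAB => <-.
have [/existsP[a /andP[Aa ax]]|nA] := boolP [exists a, (a \in A) && e a x].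
  have Bx b : b \in B -> ~~ e b x by move=> Bb; apply: one ax.
  have [/existsP[b Bb]|nB] := boolP [exists b, b \in B].
    have Ay a' : a' \in A -> ~~ e a' y.
      move=> Aa'; apply/negP=> ay; have := one y Sy zy a' b Aa' Bb ay.
      by rewrite -xorR ?inE ?Bb ?orbT // (negPf (Bx b Bb)).
    by do 3!eexists; apply: cone_center Ls Cxy _ _ => //.
  have B_0 : B = set0.
    by apply/setP=> b; rewrite inE; apply: contraNF nB => Bb; apply/existsP;
      exists b.
  have Ay a' : a' \in A -> ~~ e a' y.
    move=> Aa'; have -> : a' = a; last by rewrite -xorR ?inE ?Aa.
    by move: leAB; rewrite B_0 cards0 => /card_le1_eqP; apply.
  by do 3!eexists; apply: cone_center Ls Cxy _ _ => // v; rewrite B_0 inE.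
have Ax a : a \in A -> ~~ e a x.
  by move=> Aa; apply: contra nA => ax; apply/existsP; exists a; rewrite Aa.
have [/existsP[b /andP[Bb bYy]]|nB] := boolP [exists b, (b \in B) && e b y].
  have A_0 : A = set0.
    apply/setP=> a; rewrite inE; apply/negP=> Aa.
    by have := one y Sy zy a b Aa Bb;
      rewrite bYy -[e a y]negbK -xorR ?inE ?Aa // Ax // => /(_ isT).
  have Bx b' : b' \in B -> ~~ e b' x.
    move=> Bb'; have -> : b' = b; last by rewrite xorR ?negbK ?inE ?Bb ?orbT.
    by move: leBA; rewrite A_0 cards0 => /card_le1_eqP; apply.
  by do 3!eexists; apply: cone_center Ls Cxy _ _ => // v; rewrite A_0 inE.
do 3!eexists; apply: cone_center L C _ _ => // b Bb.
by apply: contra nB => bYy; apply/existsP; exists b; rewrite Bb.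
Qed.

Lemma K4_free_sub (S R : {set T}) : R \subset S -> K4_free e S -> K4_free e R.
Proof.
by move=> /subsetP sRS K4S a b c d /sRS Sa /sRS Sb /sRS Sc /sRS Sd; apply: K4S.
Qed.

Lemma K4_free_bound (S : {set T}) : K4_free e S ->
  arcs e S S <= 2 * kval #|S| /\
  (0 < #|S| -> arcs e S S = 2 * kval #|S| -> exists c A B, cone e S c A B).
Proof.
have [n] := ubnP #|S|; elim: n S => // n IHn S leSn K4S.
have [|Snz] := posnP #|S|.
  by move/eqP; rewrite cards_eq0 => /eqP->; rewrite /arcs big_set0.
have [/cards1P[c Dc]|S1] := boolP (#|S| == 1).
  rewrite Dc /arcs !big_set1 eirr cards1; split=> // _ _.
  exists c, set0, set0; split; rewrite ?setU0 ?cards0 ?inE ?disjoints0 //.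
    by rewrite -setI_eq0 setI0.
  by split=> [u|u v|u v|u v]; rewrite ?inE.
have [/cards2P[c [a [nca Dca]]]|S2] := boolP (#|S| == 2).
  rewrite /arcs Dca !big_setU1 ?inE // !big_set1 big_setU1 ?inE // big_set1
    !eirr.
  rewrite cards2 nca (esym a); case ca: (e c a); split=> // _ _.
  exists c, [set a], set0; split; rewrite ?setU0 ?cards0 ?cards1 ?inE //.
    by rewrite -setI_eq0 setI0.
  split=> [u|u v|u v|u v]; rewrite ?inE ?orbF //.
    by move=> /eqP->.
  by move=> /eqP-> /eqP->; rewrite eirr.
have [m m_gt0 Sm] : exists2 m, 0 < m & #|S| = 2 + m.
  by exists (#|S| - 2); lia.
have kvalS : kval #|S| = kval m + m + 2 by rewrite Sm kvalD2.
have [/exists_inP[x0 Sx0 /exists_inP[y0 Sy0 exy0]]|edgeless] := boolP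
  [exists x in S, exists y in S, e x y]; last first.
  suff -> : arcs e S S = 0 by rewrite kvalS; split; first by []; move=> _; lia.
  apply: big1 => x Sx; apply: big1 => y Sy.
  by have /exists_inPn/(_ x Sx)/exists_inPn/(_ y Sy)/negPf-> := edgeless.
have [x [y [Sx Sy exy xy1]]] := exists_light_edge esym eirr P6free K4S Sx0 Sy0
  exy0.
have Us : uniq [:: x; y] by rewrite /= inE (edge_neq eirr exy).
have sS : {subset [:: x; y] <= S}.
  by move=> v; rewrite !inE => /orP[]/eqP->.
have := cards_setD_seq Us sS; rewrite (arcs_del esym Us sS).
set R := S :\: _ => cardR.
have DR : R = S :\ x :\ y.
  by apply/setP=> v; rewrite /R !inE negb_or; case: (v == x); case: (v == y).
have {cardR} Rm : #|R| = m by move: cardR => /=; lia.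
have K4R : K4_free e R by apply: K4_free_sub K4S; apply: subsetDl.
have [|leR eqR] := IHn R _ K4R.
  by rewrite Rm; move: leSn; rewrite Sm; clear; lia.
have orb1 : \sum_(v in R) (e v x || e v y) <= 1 * #|R|.
  by apply: sum_leq_card => v _; case: (_ || _).
pose both := [set v in R | e v x && e v y].
have both1 : #|both| <= 1.
  apply/card_le1_eqP => u v; rewrite !inE.
  by case/andP=> /andP[_ Su] /andP[ux uy] /andP[/andP[_ Sv] /andP[vx vy]];
    apply: xy1.
have splitR : \sum_(v in R) \sum_(w <- [:: x; y]) e v w
    = \sum_(v in R) (e v x || e v y) + #|both|.
  have -> : #|both| = \sum_(v in R | e v x && e v y) 1.
    by rewrite -sum1_card; apply: eq_bigl => v; rewrite inE.
  rewrite big_mkcondr -big_split /=; apply: eq_bigr => v _.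
  by rewrite unlock /=; case: (e v x); case: (e v y).
have arcsxy : arcs_seq e [:: x; y] = 2.
  by rewrite /arcs_seq unlock /= !eirr (esym y) exy.
rewrite Rm in orb1 leR eqR; rewrite kvalS splitR arcsxy; split; first by lia.
move=> _ arcsS.
have [orbR both_1] : \sum_(v in R) (e v x || e v y) = m /\ #|both| = 1 by lia.
have [|c [A [B C]]] := eqR m_gt0; first by lia.
have /cards1P[z Dz] : #|both| == 1 by rewrite both_1.
have : z \in both by rewrite Dz inE.
rewrite !inE => /andP[/andP[_ Sz] /andP[zx zy]].
rewrite DR in C; apply: (@cone_step _ x y z _ _ _ K4S) C.
split=> //; split=> // v Sv nvx nvy nvz.
have Rv : v \in R by rewrite DR !inE nvx nvy.
have : v \notin both by rewrite Dz inE.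
rewrite inE Rv /=; have : ((e v x || e v y) : nat) = 1.
  apply: (sum_eq_card (D := R) (F := fun v => e v x || e v y : nat)) => //.
    by move=> w _; case: (_ || _).
  by rewrite orbR Rm mul1n.
by case: (e v x); case: (e v y).
Qed.


End K4Free.

Section Cliques.

Variables (T : finType) (e : rel T).
Hypotheses (esym : symmetric e) (eirr : irreflexive e).
Hypothesis P6free : P6sq_free e.

Definition deg (v : T) (D : {set T}) : nat := \sum_(y in D) e v y.

Lemma deg_card v (D : {set T}) : deg v D = #|[set y in D | e v y]|.
Proof.
rewrite -sum1_card /deg big_mkcond [RHS]big_mkcond /=.
by apply: eq_bigr => y _; rewrite inE; case: (y \in D); case: (e v y).
Qed.

Lemma deg_leq v (D : {set T}) : deg v D <= #|D|.
Proof. by rewrite deg_card; apply/subset_leq_card/subsetP=> y;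
  rewrite inE => /andP[]. Qed.

Lemma deg_full v (D : {set T}) : #|D| <= deg v D -> {in D, forall y, e v y}.
Proof.
rewrite deg_card => leD y Dy; have := Dy.
have /eqP<- : [set y in D | e v y] == D; last by rewrite inE Dy.
by rewrite eqEcard leD andbT; apply/subsetP=> z; rewrite inE => /andP[].
Qed.

Lemma deg_gt0 v (D : {set T}) : 0 < deg v D -> exists2 y, y \in D & e v y.
Proof.
by rewrite deg_card => /card_gt0P[y]; rewrite inE => /andP[Dy vy]; exists y.
Qed.

Lemma deg_eq0 v (D : {set T}) : {in D, forall y, ~~ e v y} -> deg v D = 0.
Proof. by move=> vD; apply: big1 => y /vD/negPf->. Qed.

Lemma degU v (A B : {set T}) : [disjoint A & B] -> deg v (A :|: B) = deg v A +
  deg v B.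
Proof. by move=> dAB; rewrite /deg -bigU //; apply: eq_bigl => y;
  rewrite !inE. Qed.

Lemma deg_sub_card v (D : {set T}) : v \in D -> deg v D < #|D|.
Proof.
move=> Dv; rewrite deg_card; apply: proper_card; apply/properP; split.
  by apply/subsetP=> y; rewrite inE => /andP[].
by exists v; rewrite // inE eirr andbF.
Qed.

Lemma arcs_leq_complete (D : {set T}) : arcs e D D <= #|D| * #|D|.-1.
Proof.
rewrite mulnC; apply: sum_leq_card => v Dv.
by have := deg_sub_card Dv; rewrite /deg; case: #|D|.
Qed.

Lemma arcs_indep (D : {set T}) : {in D &, forall x y, ~~ e x y} -> arcs e D D =
  0.
Proof. by move=> D0; apply: big1 => x Dx; apply: deg_eq0 => y; apply: D0. Qed.

Definition clique (K : {set T}) : bool :=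
  [forall x in K, forall y in K, (x != y) ==> e x y].

Lemma cliqueP {K x y} : clique K -> x \in K -> y \in K -> x != y -> e x y.
Proof. by move=> /forall_inP/[apply] /forall_inP/[apply] /implyP/[apply]. Qed.

Definition clique_free k (S : {set T}) : Prop :=
  forall K : {set T}, K \subset S -> clique K -> #|K| <> k.

Lemma clique_free_sub k (S R : {set T}) :
  R \subset S -> clique_free k S -> clique_free k R.
Proof. by move=> sRS Sk K sKR; apply: Sk; apply: subset_trans sRS. Qed.

Lemma clique_ext (K : {set T}) v : clique K -> {in K, forall y, e v y} ->
  clique (v |: K).
Proof.
move=> cK vK; apply/forall_inP=> x /setU1P[->|Kx];
  apply/forall_inP=> y /setU1P[->|Ky];
  apply/implyP.
- by rewrite eqxx.
- by move=> _; apply: vK.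
- by move=> _; rewrite esym vK.
- exact: cliqueP cK Kx Ky.
Qed.

Lemma notin_full_adj (K : {set T}) v : {in K, forall y, e v y} -> v \notin K.
Proof. by move=> vK; apply/negP=> /vK; rewrite eirr. Qed.

Lemma clique_free4 (S : {set T}) : clique_free 4 S -> K4_free e S.
Proof.
move=> S4 a b c d Sa Sb Sc Sd ab ac ad bc bd cd.
have cl1 : clique [set d].
  by apply/forall_inP=> x; rewrite inE => /eqP->; apply/forall_inP=> y;
    rewrite inE => /eqP->; rewrite eqxx.
have cd' : {in [set d], forall y, e c y} by move=> y; rewrite inE => /eqP->.
have b' : {in c |: [set d], forall y, e b y} by move=> y;
  rewrite !inE => /orP[]/eqP->.
have a' : {in b |: (c |: [set d]), forall y, e a y}.
  by move=> y; rewrite !inE => /or3P[]/eqP->.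
apply: (S4 (a |: (b |: (c |: [set d])))).
- by apply/subsetP=> y; rewrite !inE => /or4P[]/eqP->.
- by do 3!apply: clique_ext => //.
by rewrite !cardsU1 !notin_full_adj // cards1.
Qed.

Lemma fat_triangle_indep (S A : {set T}) y y' : clique_free 5 S ->
  A \subset S -> clique A -> #|A| = 3 -> y \in S -> y' \in S ->
  {in A, forall z, e y z} -> {in A, forall z, e y' z} -> ~~ e y y'.
Proof.
move=> S5 sAS cA A3 Sy Sy' yA y'A; apply/negP=> yy'.
have yA' : {in y' |: A, forall z, e y z} by move=> z /setU1P[->|/yA].
apply: (S5 (y |: (y' |: A))).
- by rewrite !subUset !sub1set Sy Sy'.
- by do 2!apply: clique_ext => //.
by rewrite !cardsU1 !notin_full_adj // A3.
Qed.

Lemma fat_triangle_out (A : {set T}) y y' w a : clique A -> #|A| = 3 ->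
  {in A, forall z, e y z} -> {in A, forall z, e y' z} -> y != y' ->
  w \notin A -> w != y' -> a \in A -> e w a -> ~~ e w y.
Proof.
move=> cA A3 yA y'A nyy' Aw nwy' Aa wa; apply/negP=> wy.
have : 1 < #|A :\ a| by rewrite (cardsD1 a) Aa add1n in A3; case: A3 => ->.
case/card_gt1P=> b [c []]; rewrite !inE => /andP[nba Ab] /andP[nca Ac] nbc.
have nAw z : z \in A -> z != w by apply: contraTneq => ->.
apply: (@noP6sq _ _ eirr P6free c y' b a y w).
- by rewrite esym y'A.
- by apply: cliqueP Ac Ab _; rewrite // eq_sym.
- exact: y'A.
- exact: y'A.
- exact: cliqueP Ab Aa nba.
- by rewrite esym yA.
- by rewrite esym yA.
- by rewrite esym.
- by rewrite esym.
- rewrite nca [c == y]eq_sym (edge_neq eirr (yA c Ac)) (nAw c Ac) (nAw b Ab).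
  by rewrite [y' == y]eq_sym nyy' [y' == w]eq_sym nwy'.
Qed.

Lemma K4_indep (K : {set T}) u v : clique K -> #|K| = 4 -> u \notin K -> v
  \notin K ->
  1 < deg u K -> 1 < deg v K -> ~~ e u v.
Proof.
move=> cK K4 Ku Kv; rewrite deg_card => /card_gt1P[p [q []]].
rewrite !inE => /andP[Kp up] /andP[Kq uq] npq v2; apply/negP=> uv.
have : 1 < #|K :\ p :\ q|.
  by move: K4; rewrite (cardsD1 p) Kp (cardsD1 q) !inE eq_sym npq Kq !add1n;
    case=> ->.
case/card_gt1P=> r [s []]; rewrite !inE.
move=> /and3P[nrq nrp Kr] /and3P[nsq nsp Ks] nrs.
have DK : K :\ p :\ q = [set r; s].
  apply/eqP; rewrite eq_sym eqEcard cards2 nrs; apply/andP; split.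
    by apply/subsetP=> z; rewrite !inE => /orP[]/eqP->;
      rewrite ?nrq ?nrp ?nsq ?nsp.
  by move: K4; rewrite (cardsD1 p) Kp (cardsD1 q) !inE eq_sym npq Kq !add1n;
    case=> ->.
have nK z w : z \in K -> w \notin K -> z != w by move=> Kz;
  apply: contraNneq => <-.
have K_ := cliqueP cK.
have shared x x' : x \in K -> x' \in K -> x != x' -> r != x -> r != x' ->
    s != x -> s != x' -> e u x -> e u x' -> ~~ e x v.
  move=> Kx Kx' nxx' nrx nrx' nsx nsx' ux ux'; apply/negP=> xv.
  apply: (@noP6sq _ _ eirr P6free r s x' x u v) => //;
    try by [apply: K_ | apply: K_; rewrite // eq_sym | rewrite esym].
  by rewrite nrx !nK.
have pv : ~~ e p v by apply: (shared p q).
have qv : ~~ e q v by apply: (shared q p); rewrite // eq_sym.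
have /deg_full vrs : #|[set r; s]| <= deg v [set r; s].
  rewrite cards2 nrs -DK; move: v2;
    rewrite /deg (bigD1 p) //= (bigD1 q) ?Kq 1?eq_sym //=.
  rewrite ![e v _]esym (negPf pv) (negPf qv) !add0n; move/leq_trans; apply.
  by apply: eq_leq; apply: eq_bigl => z; rewrite !inE; case: (z == p);
    case: (z == q); case: (z \in K).
apply: (@noP6sq _ _ eirr P6free u p q r s v) => //;
  try by [apply: K_ | apply: K_; rewrite // eq_sym].
- by rewrite esym vrs // !inE eqxx.
- by rewrite esym vrs // !inE eqxx orbT.
by rewrite ![u == _]eq_sym [v == u]eq_sym (edge_neq eirr uv) [p == s]eq_sym nsp
  !nK.
Qed.

Lemma K5_out (K : {set T}) v : clique K -> #|K| = 5 -> v \notin K -> deg v K <=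
  1.
Proof.
move=> cK K5 Kv; rewrite leqNgt deg_card; apply/negP=> /card_gt1P[p [q []]].
rewrite !inE => /andP[Kp vp] /andP[Kq vq] npq.
have : 2 < #|K :\ p :\ q|.
  by move: K5; rewrite (cardsD1 p) Kp (cardsD1 q) !inE eq_sym npq Kq !add1n;
    case=> ->.
case/card_gt2P=> r [s [t [[]]]]; rewrite !inE.
move=> /and3P[nrq nrp Kr] /and3P[nsq nsp Ks] /and3P[ntq ntp Kt] [nrs nst ntr].
have nK z : z \in K -> v != z by move=> Kz; apply: contraNneq Kv => ->.
have K_ := cliqueP cK.
apply: (@noP6sq _ _ eirr P6free v p q r s t) => //;
  try by [apply: K_ | apply: K_; rewrite // eq_sym].
by rewrite !nK // [p == s]eq_sym nsp [p == t]eq_sym ntp [q == t]eq_sym ntq.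
Qed.

End Cliques.

Section FatTriangles.

Variables (T : finType) (e : rel T).
Hypotheses (esym : symmetric e) (eirr : irreflexive e).

Definition P4_free (X : {set T}) : Prop :=
  forall p q r s, p \in X -> q \in X -> r \in X -> s \in X ->
  uniq [:: p; q; r; s] -> e p q -> e q r -> e r s -> False.

Definition P4_free_join (S : {set T}) : Prop :=
  exists X : {set T}, [/\ X \subset S, P4_free X & {in S :\: X &, forall x y,
    ~~ e x y}].

Lemma arcs_del_bound (S D : {set T}) k m : D \subset S ->
  (forall v, v \in S :\: D -> deg e v D <= k) -> arcs e D D <= m ->
  arcs e (S :\: D) (S :\: D) <= 2 * exval #|S :\: D| ->
  arcs e S S <= m + 2 * (k * (#|S| - #|D|)) + 2 * exval (#|S| - #|D|) /\
  (m + 2 * (k * (#|S| - #|D|)) + 2 * exval (#|S| - #|D|) <= arcs e S S ->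
   forall v, v \in S :\: D -> deg e v D = k).
Proof.
move=> sDS degD arcsD; have cardR : #|S| - #|D| = #|S :\: D|.
  by rewrite cardsD (setIidPr sDS).
rewrite (arcs_split esym sDS) cardR => arcsR.
have := sum_leq_card degD; rewrite -/(arcs e (S :\: D) D) => arcsRD.
split=> [|leS]; first by move: arcsD arcsR arcsRD; clear; lia.
apply: (sum_eq_card degD); rewrite -/(arcs e (S :\: D) D).
by move: arcsD arcsR leS; clear; lia.
Qed.

Hypothesis P6free : P6sq_free e.

(* Delete the triangle A and k = min(3, |Y|) of its common neighbours: a vertex
   adjacent to A has no neighbour in Y, so every other vertex sends at most k
   edges to the deleted set. *)
Lemma fat_triangle_bound (S A : {set T}) : clique_free e 5 S ->
  (forall R : {set T}, R \proper S -> arcs e R R <= 2 * exval #|R|) ->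
  A \subset S -> clique e A -> #|A| = 3 ->
  1 < #|[set y in S | [forall a in A, e y a]]| ->
  arcs e S S <= 2 * exval #|S| /\
  (5 < #|S| -> arcs e S S = 2 * exval #|S| -> P4_free_join S).
Proof.
move=> S5 IHS sAS cA A3; set Y := [set y in S | _] => Y2.
have YP y : y \in Y -> y \in S /\ {in A, forall a, e y a}.
  by rewrite inE => /andP[Sy /forall_inP].
have Y0 : {in Y &, forall x y, ~~ e x y}.
  move=> y y' /YP[Sy yA] /YP[Sy' y'A].
  exact: fat_triangle_indep S5 sAS cA A3 Sy Sy' yA y'A.
have dAY : [disjoint A & Y].
  apply/pred0P=> a /=; apply/negP=> /andP[Aa /YP[_ /(_ a Aa)]].
  by rewrite eirr.
have outY v : v \notin A -> v \notin Y -> 0 < deg e v A -> {in Y, forall y, ~~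
  e v y}.
  move=> Av Yv /deg_gt0[a Aa va] y Yy; have [_ yA] := YP y Yy.
  have : 0 < #|Y :\ y| by move: Y2; rewrite (cardsD1 y) Yy add1n.
  case/card_gt0P=> y'; rewrite in_setD1 => /andP[ny'y Yy'].
  have [_ y'A] := YP y' Yy';
    apply: fat_triangle_out cA A3 yA y'A _ Av _ Aa va => //.
    by rewrite eq_sym.
  by apply: contraNneq Yv => ->.
have degA v : v \in S -> v \notin Y -> deg e v A <= 2.
  move=> Sv; rewrite leqNgt -A3; apply: contra => /deg_full vA.
  by rewrite inE Sv; apply/forall_inP.
pose k := minn 3 #|Y|.
have /card_geqP[s [Us sz_s sYs]] : k <= #|Y| by apply: geq_minr.
pose Y' : {set T} := [set y in s].
have Y'k : #|Y'| = k by rewrite cardsE (card_uniqP Us).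
have sY'Y : Y' \subset Y by apply/subsetP=> y; rewrite inE => /sYs.
have Y'Y y : y \in Y' -> y \in Y by move/(subsetP sY'Y).
have k2 : k <= 2 -> Y' = Y.
  by move=> lek2; apply/eqP; rewrite eqEcard sY'Y Y'k leq_min leqnn andbT;
    move: lek2; rewrite /k; clear; lia.
have dAY' : [disjoint A & Y'] by apply: disjointWr dAY.
pose D := A :|: Y'.
have cardD : #|D| = 3 + k by rewrite cardsU (disjoint_setI0 dAY') cards0 subn0
  A3 Y'k.
have sDS : D \subset S.
  by rewrite subUset sAS; apply/subsetP=> y /Y'Y/YP[].
have arcsD : arcs e D D <= 6 + 6 * k.
  rewrite (@arcs_split _ _ esym D A) ?subsetUl //.
  have -> : D :\: A = Y' by rewrite setDUl setDv set0U; apply/setDidPl;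
    rewrite disjoint_sym.
  rewrite (arcs_indep (D := Y')); last by move=> x y /Y'Y Yx /Y'Y; apply: Y0.
  have := arcs_leq_complete eirr A; rewrite A3.
  have : arcs e Y' A <= 3 * #|Y'| by apply: sum_leq_card => y _;
    rewrite -A3 deg_leq.
  by rewrite Y'k; clear; lia.
have degD v : v \in S :\: D -> deg e v D <= k.
  rewrite in_setD in_setU negb_or => /andP[/andP[Av Y'v] Sv]; rewrite degU //.
  have [Yv|Yv] := boolP (v \in Y).
    rewrite (@deg_eq0 _ _ v Y') ?addn0; last by move=> y /Y'Y; apply: Y0.
    have k3 : 3 <= k by rewrite ltnNge; apply: contra Y'v => /k2->.
    by rewrite (leq_trans _ k3) // -A3 deg_leq.
  have [->|degA0] := posnP (deg e v A); first by rewrite add0n -Y'k deg_leq.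
  rewrite (@deg_eq0 _ _ v Y') ?addn0; last by move=> y /Y'Y; apply: outY.
  by rewrite (leq_trans (degA v Sv Yv)) // leq_min Y2.
have [|] := arcs_del_bound sDS degD arcsD.
  apply: IHS; apply/properP; split; first exact: subsetDl.
  have /card_gt0P[d Dd] : 0 < #|D| by rewrite cardD.
  by exists d; [apply: (subsetP sDS) | rewrite inE Dd].
have : 3 + k <= #|S| by rewrite -cardD subset_leq_card.
rewrite cardD; have [k3|lek2] := ltnP 2 k; last first.
  have -> : k = 2 by apply/eqP; rewrite eqn_leq lek2 leq_min Y2.
  rewrite -[3 + 2]/5 => /subnKC <-; rewrite addKn;
    move: (#|S| - 5) => m bound _.
  have [m0|m_gt0] := posnP m; first by move: bound; rewrite m0; split.
  by move: (exvalD5 m_gt0) bound; clear; split; lia.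
have Dk : k = 3 by apply/eqP; rewrite eqn_leq k3 geq_minl.
rewrite Dk -[3 + 3]/6 => /subnKC DS bound deg_eq; split.
  by move: bound; rewrite -DS addKn exvalD6; clear; lia.
move=> _ arcsS; exists (S :\: Y); split; first exact: subsetDl.
  have /card_gt1P[y1 [y2 [Y1 Y2' ny12]]] : 1 < #|Y'| by rewrite Y'k Dk.
  have adjX v : v \in S :\: Y -> v \notin A ->
      deg e v A = 0 /\ {in Y', forall y, e v y}.
    rewrite in_setD => /andP[Yv Sv] Av.
    have Y'v : v \notin Y' by apply: contra Yv => /Y'Y.
    have := deg_eq _ v; rewrite in_setD in_setU negb_or Av Y'v Sv degU //.
    have [->|degA0] := posnP (deg e v A).
      rewrite add0n => H; split=> //; apply: deg_full; rewrite H ?Y'k ?Dk //.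
      by rewrite arcsS -DS addKn exvalD6; clear; lia.
    rewrite (@deg_eq0 _ _ v Y') ?addn0; last by move=> y /Y'Y; apply: outY.
    have := degA v Sv Yv => le2 H; move: le2; rewrite H //.
    by rewrite arcsS -DS addKn exvalD6; clear; lia.
  have sideA u v : u \in S :\: Y -> v \in S :\: Y -> e u v -> (u \in A) = (v
    \in A).
    move=> Xu Xv uv; apply/idP/idP; apply: contraLR => Anv; apply/negP=> Anu.
      have [/eqP] := adjX v Xv Anv;
        rewrite /deg sum_nat_eq0 => /forall_inP/(_ u Anu).
      by rewrite esym uv.
    have [/eqP] := adjX u Xu Anv;
      rewrite /deg sum_nat_eq0 => /forall_inP/(_ v Anu).
    by rewrite uv.
  move=> p q r s' Xp Xq Xr Xs U pq qr rs.
  have [Aq Ar As] : [/\ (q \in A) = (p \in A), (r \in A) = (p \in A) & (s' \in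
    A) = (p \in A)].
    by rewrite -(sideA r s') // -(sideA q r) // -(sideA p q).
  have [Ap|Ap] := boolP (p \in A).
    suff : 3 < #|A| by rewrite A3.
    apply/card_geqP; exists [:: p; q; r; s']; split=> //.
    by move=> z; rewrite !inE => /or4P[]/eqP->; rewrite ?Aq ?Ar ?As.
  have Y'X v : v \in S :\: Y -> (v \in A) = (p \in A) -> e v y1 /\ e v y2.
    move=> Xv Av; have [|_ vY] := adjX v Xv; first by rewrite Av.
    by split; apply: vY.
  have [[p1 p2] [q1 q2]] := (Y'X p Xp erefl, Y'X q Xq Aq).
  have [[r1 r2] [s1 s2]] := (Y'X r Xr Ar, Y'X s' Xs As).
  have nXY v y : v \in S :\: Y -> y \in Y' -> v != y.
    by rewrite in_setD => /andP[Yv _] /Y'Y; apply: contraTneq => <-.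
  move: U; rewrite /= !inE !negb_or andbT.
  case/and3P=> /and3P[npq npr nps] /andP[nqr nqs] nrs.
  apply: (@noP6sq _ _ eirr P6free y1 p q y2 r s') => //; try by rewrite esym.
  by rewrite ny12 ![y1 == _]eq_sym (nXY r y1) // (nXY s' y1) // npr nps nqs.
move=> x y; rewrite !in_setD => /andP[xX Sx] /andP[yX Sy].
by apply: Y0; [move: xX | move: yX]; rewrite negb_and negbK ?Sx ?Sy orbF.
Qed.

End FatTriangles.

Section EdgeBound.

Variables (T : finType) (e : rel T).
Hypotheses (esym : symmetric e) (eirr : irreflexive e).
Hypothesis P6free : P6sq_free e.

Lemma clique_sub (K A : {set T}) : A \subset K -> clique e K -> clique e A.
Proof.
move=> /subsetP sAK cK; apply/forall_inP=> x /sAK Kx;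
  apply/forall_inP=> y /sAK Ky.
by apply/implyP; apply: cliqueP cK Kx Ky.
Qed.

Lemma thin_K4_bound (S K : {set T}) :
  (forall R : {set T}, R \proper S -> arcs e R R <= 2 * exval #|R|) ->
  (forall A : {set T}, A \subset S -> clique e A -> #|A| = 3 ->
    #|[set y in S | [forall a in A, e y a]]| <= 1) ->
  K \subset S -> clique e K -> #|K| = 4 ->
  arcs e S S <= 2 * exval #|S| /\ (5 < #|S| -> arcs e S S < 2 * exval #|S|).
Proof.
move=> IHS thin sKS cK K4.
have degK v : v \in S :\: K -> deg e v K <= 2.
  rewrite in_setD => /andP[Kv Sv]; rewrite leqNgt deg_card.
  apply/negP=> /card_geqP[s [Us sz_s sK]]; pose A : {set T} := [set x in s].
  have A3 : #|A| = 3 by rewrite cardsE (card_uniqP Us).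
  have sAK : A \subset K by apply/subsetP=> x; rewrite inE => /sK;
    rewrite inE => /andP[].
  have : 0 < #|K :\: A| by rewrite cardsD (setIidPr sAK) A3 K4.
  case/card_gt0P=> d; rewrite in_setD => /andP[Ad Kd].
  have := thin A (subset_trans sAK sKS) (clique_sub sAK cK) A3.
  apply/negP; rewrite -ltnNge; apply/card_gt1P; exists v, d; split.
  - rewrite inE Sv; apply/forall_inP=> x; rewrite inE => /sK.
    by rewrite inE => /andP[].
  - rewrite inE (subsetP sKS) //; apply/forall_inP=> x Ax.
    by apply: cliqueP cK _ _ _ => //;
      [apply: (subsetP sAK) | apply: contraNneq Ad => ->].
  - by apply: contraNneq Kv => ->.
pose R := S :\: K; pose Z := [set v in R | 1 < deg e v K]; pose W := R :\: Z.
have sZR : Z \subset R by apply/subsetP=> v; rewrite inE => /andP[].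
have cardR : #|R| = #|Z| + #|W| by rewrite -(cardsID Z R) (setIidPr sZR).
have cardS : #|S| = 4 + (#|Z| + #|W|).
  by rewrite -cardR -(cardsID K S) (setIidPr sKS) K4.
have arcsRK : arcs e R K <= 2 * #|Z| + #|W|.
  rewrite (arcs_splitl _ _ sZR) leq_add //.
    by apply: sum_leq_card => v Zv; apply: degK; apply: (subsetP sZR).
  rewrite -[#|W|]mul1n; apply: sum_leq_card => v.
  by rewrite in_setD inE => /andP[+ Rv]; rewrite Rv -leqNgt.
have Z0 : {in Z &, forall x y, ~~ e x y}.
  move=> x y; rewrite !inE => /andP[/andP[Kx _] x2] /andP[/andP[Ky _] y2].
  exact: K4_indep cK K4 Kx Ky x2 y2.
have arcsR : arcs e R R <= 2 * (#|Z| * #|W|) + #|W| * #|W|.-1.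
  rewrite (arcs_split esym sZR) (arcs_indep Z0) add0n leq_add
    ?arcs_leq_complete //.
  by rewrite leq_mul2l; apply: sum_leq_card => v _; apply: deg_leq.
have IHR : arcs e R R <= 2 * exval (#|Z| + #|W|).
  rewrite -cardR; apply: IHS; apply/properP; split; first exact: subsetDl.
  have /card_gt0P[d Kd] : 0 < #|K| by rewrite K4.
  by exists d; [apply: (subsetP sKS) | rewrite inE Kd].
have := arcs_leq_complete eirr K; rewrite (arcs_split esym sKS) -/R cardS K4.
move: arcsRK arcsR IHR; move: (arcs e R K) (arcs e R R) (arcs e K K).
move: #|Z| #|W| => z w rk r k; clear=> rk_le r_le r_le' k_le.
have [w2|] := leqP 2 w.
  by have := exvalD4 (z + w); split; lia.
case: w rk_le r_le {r_le'} => [|[|//]].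
  case: z => [|z]; first by rewrite (_ : exval (4 + _) = 6) //; split; lia.
  have -> : 4 + (z.+1 + 0) = 5 + z by lia.
  by have := exval_ge3n z; split; lia.
have -> : 4 + (z + 1) = 5 + z by lia.
by have := exval_ge3n z; split; lia.
Qed.

Lemma cone_P4_free_join S c A B : cone e S c A B -> P4_free_join e S.
Proof.
case=> -> cAB dAB _ [cadj AB A0 B0]; exists (c |: A); split.
- by rewrite setUA subsetUl.
- have edgec u v : u \in c |: A -> v \in c |: A -> e u v -> (u == c) || (v ==
  c).
    case/setU1P=> [->|Au]; first by rewrite eqxx.
    case/setU1P=> [->|Av]; first by rewrite eqxx orbT.
    by rewrite (negPf (A0 u v Au Av)).
  move=> p q r s Xp Xq Xr Xs; rewrite /= !inE !negb_or andbT.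
  case/and3P=> /and3P[npq npr nps] /andP[nqr nqs] nrs.
  move=> /(edgec p q Xp Xq) pq _ /(edgec r s Xr Xs) rs.
  case/orP: pq => /eqP Dc; case/orP: rs => /eqP Dc'; subst.
  + by rewrite eqxx in npr.
  + by rewrite eqxx in nps.
  + by rewrite eqxx in nqr.
  + by rewrite eqxx in nqs.
move=> x y; rewrite !inE !negb_or => /andP[/andP[/negPf-> /negPf->] /= Bx].
by move=> /andP[/andP[/negPf-> /negPf->] /= By]; apply: B0.
Qed.

Lemma K5_free_bound (S : {set T}) : clique_free e 5 S ->
  arcs e S S <= 2 * exval #|S| /\
  (5 < #|S| -> arcs e S S = 2 * exval #|S| -> P4_free_join e S).
Proof.
have [n] := ubnP #|S|; elim: n S => // n IHn S leSn S5.
have IHS (R : {set T}) : R \proper S -> arcs e R R <= 2 * exval #|R|.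
  move=> pRS; have [|//] := IHn R _ (clique_free_sub (proper_sub pRS) S5).
  exact: leq_trans (proper_card pRS) leSn.
have [/existsP[A /and4P[sAS cA /eqP A3 Y2]]|thin] := boolP [exists A : {set T},
  [&& A \subset S, clique e A, #|A| == 3 & 1 < #|[set y in S | [forall a in A,
    e y a]]|]].
  exact: fat_triangle_bound Y2.
have [/existsP[K /and3P[sKS cK /eqP K4]]|noK4] := boolP [exists K : {set T},
  [&& K \subset S, clique e K & #|K| == 4]].
  have [|leS ltS] := thin_K4_bound IHS _ sKS cK K4.
    move=> A sAS cA A3; rewrite leqNgt; apply: contra thin => Y2.
    by apply/existsP; exists A; rewrite sAS cA A3 eqxx Y2.
  by split=> // /ltS + arcsS; rewrite arcsS ltnn.
have K4S : K4_free e S.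
  apply: clique_free4 => // K sKS cK K4; case/negP: noK4.
  by apply/existsP; exists K; rewrite sKS cK K4 eqxx.
have [leS coneS] := K4_free_bound esym eirr P6free K4S.
have lek := kval_le_exval #|S|; split; first by lia.
move=> S_gt5 arcsS; have [||c [A [B]]] := coneS; last exact: cone_P4_free_join.
  by move: S_gt5; case: #|S|.
by apply/eqP; rewrite eqn_leq leS arcsS leq_mul2l lek.
Qed.

Lemma P6sq_free_bound (S : {set T}) : 5 < #|S| ->
  arcs e S S <= 2 * exval #|S| /\
  (arcs e S S = 2 * exval #|S| -> P4_free_join e S).
Proof.
have [n] := ubnP #|S|; elim: n S => // n IHn S leSn S_gt5.
have [/existsP[K /and3P[sKS cK /eqP K5]]|noK5] := boolP [exists K : {set T},
  [&& K \subset S, clique e K & #|K| == 5]]; last first.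
  have [|leS joinS] := @K5_free_bound S; last by split; last exact: joinS.
  move=> K sKS cK K5; case/negP: noK5.
  by apply/existsP; exists K; rewrite sKS cK K5 eqxx.
suff ltS : arcs e S S < 2 * exval #|S|.
  by split; [exact: ltnW | move=> arcsS; rewrite arcsS ltnn in ltS].
pose R := S :\: K.
have cardS : #|S| = 5 + #|R| by rewrite -(cardsID K S) (setIidPr sKS) K5.
have arcsRK : arcs e R K <= 1 * #|R|.
  apply: sum_leq_card => v; rewrite in_setD => /andP[Kv _].
  exact: K5_out cK K5 Kv.
have := arcs_leq_complete eirr K; rewrite (arcs_split esym sKS) -/R K5.
have Rcomplete := arcs_leq_complete eirr R.
have IHR : 5 < #|R| -> arcs e R R <= 2 * exval #|R|.
  by move=> R_gt5; have [|//] := IHn R _ R_gt5; rewrite cardS in leSn;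
    move: leSn; clear; lia.
have R_gt0 : 0 < #|R| by rewrite cardS in S_gt5.
have := exvalD5 R_gt0; move: arcsRK Rcomplete IHR R_gt0; rewrite cardS.
move: (arcs e R K) (arcs e R R) (arcs e K K) #|R| => rk r k m; clear.
have [m_gt5|] := ltnP 5 m; first by lia.
by move: m => [|[|[|[|[|[|//]]]]]]; rewrite /exval /=; lia.
Qed.

End EdgeBound.

(* The graph induced by F_graph n i j on X; for j = 0 there are only triangles,
   which is the case of H_graph n i. *)
Definition star_triangles (j : nat) : rel nat := fun p q =>
  (p != q) && [|| [&& j <= p, j <= q & (p - j) %/ 3 == (q - j) %/ 3],
                  (p == 0) && (q < j) | (q == 0) && (p < j)].

Lemma star_trianglesC j : symmetric (star_triangles j).
Proof. by move=> p q; rewrite /star_triangles; lia. Qed.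

Lemma star_triangles_sep j m p q : j <= m -> 3 %| m - j -> p < m <= q ->
  star_triangles j p q = false.
Proof. by rewrite /star_triangles => lejm dvd3 /andP[ltpm lemq]; lia. Qed.

Lemma star_triangles_block j m i i' : j <= m -> 3 %| m - j -> i < 3 -> i' < 3 ->
  star_triangles j (m + i) (m + i') = (i != i').
Proof. by rewrite /star_triangles => lejm dvd3 lti3 lti'3; lia. Qed.

Section P4Free.

Variables (T : finType) (e : rel T).
Hypotheses (esym : symmetric e) (eirr : irreflexive e).

Lemma P4_free_sub (X Y : {set T}) : X \subset Y -> P4_free e Y -> P4_free e X.
Proof.
move=> /subsetP sXY Y4 p q r s /sXY Yp /sXY Yq /sXY Yr /sXY Ys.
exact: Y4.
Qed.

Lemma arcs_split_isolated (X C : {set T}) : C \subset X ->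
  {in C & X :\: C, forall u w, ~~ e u w} ->
  arcs e X X = arcs e C C + arcs e (X :\: C) (X :\: C).
Proof.
move=> sCX CX; rewrite (arcs_split esym sCX) [X in 2 * X]big1 ?addn0 // => w Xw.
by apply: (@deg_eq0 _ _ w) => u Cu; rewrite esym CX.
Qed.

(* A vertex of maximum degree and its neighbours form a star component. *)
Lemma triangle_free_P4_free (X : {set T}) :
  P4_free e X -> {in X & &, forall a b c, ~~ [&& e a b, e a c & e b c]} ->
  0 < #|X| ->
  arcs e X X + 2 <= 2 * #|X| /\
  (arcs e X X + 4 <= 2 * #|X| \/ exists2 c, c \in X &
    {in X :\ c, forall u, e c u} /\ {in X :\ c &, forall u w, ~~ e u w}).
Proof.
have [n] := ubnP #|X|; elim: n X => // n IHn X leXn X4 X3.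
case/card_gt0P=> v0 Xv0.
pose v := [arg max_(v > v0 | v \in X) deg e v X].
have [Xv maxv] : v \in X /\ forall u, u \in X -> deg e u X <= deg e v X.
  by rewrite /v; case: arg_maxnP.
clearbody v; clear v0 Xv0; pose N := [set u in X | e v u].
have NP u : u \in N -> u \in X /\ e v u by rewrite inE => /andP[].
have Nv : v \notin N by rewrite inE eirr andbF.
pose C := v |: N; have sCX : C \subset X.
  by rewrite subUset sub1set Xv; apply/subsetP=> u /NP[].
have N0 : {in N &, forall u w, ~~ e u w}.
  by move=> u w /NP[Xu vu] /NP[Xw vw]; have := X3 v u w Xv Xu Xw; rewrite vu vw.
have arcsC2 : arcs e C C + 2 = 2 * #|C|.
  rewrite (@arcs_split _ _ esym C [set v]) ?sub1set ?setU11 // setU1K //.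
  rewrite (arcs_indep N0) /arcs !big_set1 eirr cardsU1 Nv.
  rewrite (eq_bigr (fun=> 1)) ?sum1_card ?addn0; first by lia.
  by move=> u /NP[_ vu]; rewrite big_set1 esym vu.
have isoC : {in C & X :\: C, forall u w, ~~ e u w}.
  move=> u w; rewrite in_setD !in_setU1 negb_or => Cu /andP[/andP[nwv Nw] Xw].
  have nvw : ~~ e v w by move: Nw; rewrite inE Xw.
  case/predU1P: Cu => [-> // | Nu]; apply/negP=> uw; have [Xu vu] := NP u Nu.
  have : 1 < deg e u X.
    rewrite deg_card; apply/card_gt1P; exists v, w.
    by rewrite !inE Xv Xw uw esym vu eq_sym nwv.
  move/leq_trans/(_ (maxv u Xu)); rewrite deg_card -/N (cardsD1 u) Nu ltnS.
  case/card_gt0P=> u'; rewrite in_setD1 => /andP[nu'u Nu'].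
  have [Xu' vu'] := NP u' Nu'; apply: (X4 w u v u') => //; try by rewrite esym.
  rewrite /= !inE !negb_or nwv eq_sym (edge_neq eirr uw) [u == v]eq_sym.
  rewrite (edge_neq eirr vu) [u == u']eq_sym nu'u (edge_neq eirr vu') !andbT.
  by apply: contraNneq Nw => ->.
have [R0|R_gt0] := posnP #|X :\: C|.
  have DX : X = C.
    by apply/eqP; rewrite eqEsubset sCX andbT -setD_eq0 -cards_eq0 R0.
  rewrite {1 2}DX {1}DX arcsC2; split=> //; right; exists v => //.
  by rewrite DX setU1K //; split=> // u /NP[].
have cardX : #|X| = #|C| + #|X :\: C| by rewrite -(cardsID C X) (setIidPr sCX).
have C_gt0 : 0 < #|C| by rewrite cardsU1 Nv.
rewrite (arcs_split_isolated sCX isoC).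
have [|||leR _] := IHn (X :\: C) _ _ _ R_gt0.
- by move: leXn; rewrite cardX; move: C_gt0; clear; lia.
- exact: P4_free_sub (subsetDl _ _) X4.
- by move=> a b c /setDP[Xa _] /setDP[Xb _] /setDP[Xc _]; apply: X3.
by move: arcsC2 leR; rewrite cardX; clear; split; [|left]; lia.
Qed.

Lemma P4_free_classify (x0 : T) (X : {set T}) : P4_free e X ->
  arcs e X X + 4 <= 2 * #|X| \/
  exists j (s : seq T), [/\ uniq s, s =i X, j <= size s, 3 %| size s - j &
    arcs e X X + 2 * (0 < j) = 2 * #|X| /\
    forall p q, p < size s -> q < size s ->
      e (nth x0 s p) (nth x0 s q) = star_triangles j p q].
Proof.
have [n] := ubnP #|X|; elim: n X => // n IHn X leXn X4.
have [/exists_inP[a Xa /exists_inP[b Xb /exists_inP[c Xc /and3P[ab ac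
  bc]]]]|X3] :=
  boolP [exists a in X, exists b in X, exists c in X, [&& e a b, e a c & e b
    c]].
  have Ut : uniq [:: a; b; c].
    by rewrite /= !inE negb_or (edge_neq eirr ab) (edge_neq eirr ac) (edge_neq
      eirr bc).
  pose C := [set x in [:: a; b; c]].
  have sCX : C \subset X.
    by apply/subsetP=> x; rewrite !inE => /or3P[]/eqP->.
  have isoC : {in C & X :\: C, forall u w, ~~ e u w}.
    move=> u w; rewrite in_setD => Cu /andP[Cw Xw]; apply/negP=> uw.
    have nCw x : x \in C -> w != x by move=> Cx; apply: contraNneq Cw => ->.
    have Cabc : [/\ a \in C, b \in C & c \in C] by rewrite !inE !eqxx !orbT.
    have [Ca Cb Cc] := Cabc; have [ba ca cb] : [/\ e b a, e c a & e c b].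
      by rewrite ![e _ a]esym [e c b]esym.
    have [nab nac nbc] := And3 (edge_neq eirr ab) (edge_neq eirr ac) (edge_neq
      eirr bc).
    move: Cu uw; rewrite !inE => /or3P[]/eqP-> uw.
    + apply: (X4 w a b c); rewrite ?[e w _]esym //= !inE !negb_or !nCw //.
      by rewrite nab nac nbc.
    + apply: (X4 w b a c); rewrite ?[e w _]esym //= !inE !negb_or !nCw //.
      by rewrite [b == a]eq_sym nab nac nbc.
    + apply: (X4 w c a b); rewrite ?[e w _]esym //= !inE !negb_or !nCw //.
      by rewrite ![c == _]eq_sym nab nac nbc.
  have arcsC6 : arcs e C C = 6.
    rewrite arcs_set_seq // /arcs_seq unlock /= !eirr !ab !ac !bc.
    by rewrite [e b a]esym [e c a]esym [e c b]esym ab ac bc.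
  have C3 : #|C| = 3 by rewrite cardsE (card_uniqP Ut).
  have cardX : #|X| = 3 + #|X :\: C| by rewrite -(cardsID C X) (setIidPr sCX)
    C3.
  rewrite (arcs_split_isolated sCX isoC) arcsC6 cardX.
  have [||few|[j [s [Us sX lejs dvd3 [arcsX pat]]]]] := IHn (X :\: C).
  - by move: leXn; rewrite cardX; clear; lia.
  - exact: P4_free_sub (subsetDl _ _) X4.
  - by left; move: few; clear; lia.
  right; exists j, (s ++ [:: a; b; c]); split.
  - rewrite cat_uniq Us Ut andbT; apply/hasPn=> x Cx.
    by rewrite /= sX in_setD inE Cx.
  - move=> x; rewrite mem_cat sX in_setD -[x \in [:: _; _; _]]in_set -/C.
    by case: (boolP (x \in C)) => [/(subsetP sCX)->|]; rewrite ?orbT ?orbF.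
  - by rewrite size_cat (leq_trans lejs) ?leq_addr.
  - by rewrite size_cat -addnBAC // dvdn_addl.
  split; first by move: arcsX; clear; lia.
  have Cs p : p < 3 -> nth x0 [:: a; b; c] p \in C by move=> ltp;
    rewrite inE mem_nth.
  have Xs p : p < size s -> nth x0 s p \in X :\: C by move=> ltp;
    rewrite -sX mem_nth.
  move=> p q; rewrite size_cat /= !nth_cat => ltp ltq.
  have [ltps|leps] := ltnP p (size s); have [ltqs|leqs] := ltnP q (size s).
  - exact: pat.
  - rewrite esym (negPf (isoC _ _ _ (Xs _ ltps))) ?Cs ?ltn_subLR //.
    by rewrite (star_triangles_sep lejs dvd3) ?ltps.
  - rewrite (negPf (isoC _ _ _ (Xs _ ltqs))) ?Cs ?ltn_subLR //.
    by rewrite star_trianglesC (star_triangles_sep lejs dvd3) ?ltqs.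
  rewrite -{2}(subnKC leps) -{2}(subnKC leqs).
  have: p - size s < 3 by rewrite ltn_subLR.
  have: q - size s < 3 by rewrite ltn_subLR.
  move: (p - _) (q - _) => p' q' ltq' ltp'; rewrite star_triangles_block //.
  have [ba ca cb] : [/\ e b a, e c a & e c b] by rewrite ![e _ a]esym [e c
    b]esym.
  by case: p' q' ltp' ltq' => [|[|[|//]]] [|[|[|//]]] _ _ /=;
    rewrite ?eirr ?ab ?ac ?bc ?ba ?ca ?cb.
have [X0|X_gt0] := posnP #|X|.
  right; exists 0, [::]; move/eqP: X0; rewrite cards_eq0 => /eqP->.
  split=> //; first by move=> x; rewrite !inE.
  by rewrite /arcs big_set0 cards0.
have [||leX [few|[c Xc [cX X0]]]] := @triangle_free_P4_free X X4.
- move=> a b c Xa Xb Xc; apply: contra X3 => abc.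
  by apply/exists_inP; exists a; rewrite // ; apply/exists_inP; exists b;
    rewrite //; apply/exists_inP; exists c.
- by [].
- by left.
right; exists #|X|, (c :: enum (X :\ c)).
have sz : size (c :: enum (X :\ c)) = #|X| by rewrite /= -cardE (cardsD1 c X)
  Xc.
have cardX : #|X| = #|X :\ c|.+1 by rewrite (cardsD1 c X) Xc.
split.
- by rewrite /= mem_enum !inE eqxx enum_uniq.
- by move=> x; rewrite in_cons mem_enum -in_setU1 setD1K.
- by rewrite sz.
- by rewrite sz subnn.
split.
  rewrite (@arcs_split _ _ esym X [set c]) ?sub1set // (arcs_indep X0).
  rewrite /arcs !big_set1 eirr (eq_bigr (fun=> 1)) ?sum1_card.
    by rewrite cardX; clear; lia.
  by move=> u Xu; rewrite big_set1 esym cX.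
have Xs p : p < #|X :\ c| -> nth x0 (enum (X :\ c)) p \in X :\ c.
  by move=> ltp; rewrite -mem_enum mem_nth // -cardE.
move=> p q; rewrite sz {sz} cardX.
case: p q => [|p] [|q]; rewrite ?ltnS /star_triangles /= => ltp ltq.
- by rewrite eirr.
- by rewrite cX ?Xs // !ltnS ltq.
- by rewrite esym cX ?Xs // !ltnS ltp andbF.
- by rewrite (negPf (X0 _ _ _ _)) ?Xs //; lia.
Qed.

End P4Free.

Lemma adj_sym (T : finType) (G : sgraph T) : symmetric (adj G).
Proof. by move=> x y; rewrite /adj setUC. Qed.

Lemma edge_card (T : finType) (G : sgraph T) E : E \in edges G -> #|E| = 2.
Proof. by case: G => Es /= /forall_inP EsP /EsP/eqP. Qed.

Lemma adj_irr (T : finType) (G : sgraph T) : irreflexive (adj G).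
Proof.
by move=> x; apply/negP=> /edge_card; rewrite setUid cards1.
Qed.

Lemma adj_graph_of_rel (T : finType) (r : rel T) x y :
  adj (graph_of_rel r) x y = (x != y) && (r x y || r y x).
Proof.
apply/imset2P/andP=> [[a b _]|[nxy]].
  rewrite inE => /and3P[_ nab rab] Exy.
  have : #|[set x; y]| == 2 by rewrite Exy cards2 nab.
  rewrite cards2; case: (eqVneq x y) => //= nxy _; split=> //.
  have : x \in [set a; b] by rewrite -Exy set21.
  have : y \in [set a; b] by rewrite -Exy set22.
  rewrite !inE => /orP[]/eqP Dy /orP[]/eqP Dx; subst; rewrite ?rab ?orbT //;
    by rewrite eqxx in nxy.
case/orP=> rxy; [exists x y | exists y x]; rewrite ?inE //.
- by rewrite nxy rxy.
- by rewrite eq_sym nxy rxy.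
- exact: setUC.
Qed.

Lemma arcs_edges (T : finType) (G : sgraph T) :
  arcs (adj G) [set: T] [set: T] = 2 * #|edges G|.
Proof.
have -> : 2 * #|edges G| = \sum_(E in edges G) \sum_(x in E) 1.
  rewrite mulnC -sum_nat_const; apply: eq_bigr => E /edge_card.
  by rewrite sum1_card.
rewrite (exchange_big_dep predT) //= /arcs.
apply: eq_big => [x|x _]; first by rewrite inE.
rewrite sum1_card -[LHS]/(deg (adj G) x setT) deg_card.
rewrite -(card_in_imset (f := fun y => [set x; y])).
  apply: eq_card => E; rewrite [RHS]inE; apply/imsetP/andP.
    by case=> y; rewrite !inE => xy ->; rewrite set21.
  case=> GE Ex; have /eqP/cards2P[a [b [nab DE]]] := edge_card GE.
  move: Ex; rewrite DE !inE => /orP[]/eqP->; [exists b | exists a] => //.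
  - by rewrite !inE /adj -DE.
  - by rewrite !inE /adj setUC -DE.
  - exact: setUC.
move=> y z; rewrite !inE => xy _ Exy.
have : y \in [set x; z] by rewrite -Exy set22.
by rewrite !inE eq_sym (negPf (edge_neq (@adj_irr _ G) xy)) => /eqP.
Qed.

Lemma has_square_path6 (T : finType) (G : sgraph T) :
  ~~ has_subgraph (square_path 6) G <-> P6sq_free (adj G).
Proof.
split=> [noP6 v1 v2 v3 v4 v5 v6 Uv | P6free].
  apply: contra noP6 => /and5P[e12 e13 e23 e24 /and5P[e34 e35 e45 e46 e56]].
  pose v := [:: v1; v2; v3; v4; v5; v6].
  apply/existsP; exists [ffun i : 'I_6 => nth v1 v i]; apply/andP; split.
    apply/injectiveP=> i j; rewrite !ffunE => /eqP.
    by rewrite nth_uniq // => /eqP/val_inj.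
  apply/forallP=> i; apply/forallP=> j; rewrite !ffunE adj_graph_of_rel.
  apply/implyP=> /andP[_].
  suff le_case k l : k < 6 -> l < 6 -> k < l <= k + 2 -> adj G (nth v1 v k)
    (nth v1 v l).
    by case/orP=> ij; [| rewrite adj_sym]; apply: le_case.
  by do 7?[case: k => [|k] //]; do 7?[case: l => [|l] //].
apply/existsP=> -[f /andP[/injectiveP injf /forallP homf]].
pose o k : 'I_6 := inord k.
have Uo : uniq [:: f (o 0); f (o 1); f (o 2); f (o 3); f (o 4); f (o 5)].
  rewrite -[X in uniq X]/(map f [:: o 0; o 1; o 2; o 3; o 4;
    o 5]) map_inj_uniq //.
  by rewrite -(map_inj_uniq val_inj) /= !inordK.
have homo k l : k < l <= k + 2 -> l < 6 -> adj G (f (o k)) (f (o l)).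
  move=> /[dup] kl /andP[ltkl _] ltl; have ltk := ltn_trans ltkl ltl.
  have /forallP/(_ (o l))/implyP := homf (o k).
  apply; rewrite adj_graph_of_rel -(inj_eq val_inj) /= !inordK //.
  by rewrite kl (ltn_eqF ltkl).
by have := P6free _ _ _ _ _ _ Uo; rewrite !homo.
Qed.

Lemma join_P6sq_free (T : finType) (e : rel T) (X : {set T}) : symmetric e ->
  P4_free e X -> {in ~: X &, forall x y, ~~ e x y} -> P6sq_free e.
Proof.
move=> esym X4 Y0 v1 v2 v3 v4 v5 v6; rewrite /= !inE !negb_or andbT.
case/and5P=> /and5P[n12 n13 n14 n15 n16] /and4P[n23 n24 n25 n26] /and3P[n34 n35
  n36] /andP[n45 n46] n56.
apply/negP=> /and5P[e12 e13 e23 e24 /and5P[e34 e35 e45 e46 e56]].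
have side u v : e u v -> (u \in X) || (v \in X).
  move=> uv; rewrite -[_ || _]negbK negb_or; apply/negP=> /andP[Xu Xv].
  by have := Y0 u v; rewrite !inE uv => /(_ Xu Xv).
have path p q r s : [&& p \in X, q \in X, r \in X & s \in X] ->
    [&& p != q, p != r, p != s, q != r, q != s & r != s] ->
    e p q -> e q r -> e r s -> False.
  move=> /and4P[Xp Xq Xr Xs] n; apply: X4 => //; rewrite /= !inE !negb_or andbT.
  by case/and5P: n => -> -> -> -> /andP[-> ->].
have [X3|X3] := boolP (v3 \in X); last first.
  move: (side _ _ e13) (side _ _ e23) (side _ _ e34) (side _ _ e35).
  rewrite (negPf X3) !orbF /= => X1 X2 X4' X5.
  by apply: (path v1 v2 v4 v5) => //;
    rewrite ?X1 ?X2 ?X4' // n12 n14 n15 n24 n25.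
have [X4'|X4'] := boolP (v4 \in X); last first.
  move: (side _ _ e24) (side _ _ e45) (side _ _ e46);
    rewrite (negPf X4') orbF /= => X2 X5 X6.
  by apply: (path v2 v3 v5 v6) => //;
    rewrite ?X2 ?X3 ?X5 // n23 n25 n26 n35 n36.
have [X2|X2] := boolP (v2 \in X); last first.
  move: (side _ _ e12); rewrite (negPf X2) orbF => X1.
  case/orP: (side _ _ e56) => [X5|X6].
    by apply: (path v1 v3 v4 v5) => //;
      rewrite ?X1 ?X3 ?X4' // n13 n14 n15 n34 n35.
  by apply: (path v1 v3 v4 v6) => //;
    rewrite ?X1 ?X3 ?X4' // n13 n14 n16 n34 n36.
case/orP: (side _ _ e56) => [X5|X6].
  by apply: (path v2 v3 v4 v5) => //;
    rewrite ?X2 ?X3 ?X4' // n23 n24 n25 n34 n35.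
by apply: (path v2 v3 v4 v6) => //; rewrite ?X2 ?X3 ?X4' // n23 n24 n26 n34 n36.
Qed.

Section Isomorphism.

Variables (T U : finType) (G : sgraph T) (H : sgraph U).

Lemma isomorphic_P6sq_free : isomorphic G H -> P6sq_free (adj H) -> P6sq_free
  (adj G).
Proof.
case=> f bij_f hf H6 v1 v2 v3 v4 v5 v6 Uv.
rewrite -!hf; apply: H6.
rewrite -[X in uniq X]/(map f [:: v1; v2; v3; v4; v5; v6]) map_inj_uniq //.
exact: bij_inj.
Qed.

Lemma isomorphic_card_edges : isomorphic G H -> #|edges G| = #|edges H|.
Proof.
case=> f bij_f hf; apply/eqP;
  rewrite -(eqn_pmul2l (m := 2)) // -!arcs_edges /arcs.
apply/eqP; rewrite [RHS](reindex f) /=; last exact: onW_bij.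
apply: eq_big => [x|x _]; first by rewrite !inE.
rewrite [RHS](reindex f) /=; last exact: onW_bij.
by apply: eq_big => [y|y _]; rewrite ?inE ?hf.
Qed.

End Isomorphism.

Lemma adj_F_graph n i j (p q : 'I_n) : j <= i ->
  adj (F_graph n i j) p q =
  if (p < i) && (q < i) then star_triangles j p q else (p < i) != (q < i).
Proof.
move=> leji; rewrite adj_graph_of_rel -(inj_eq val_inj) /=.
rewrite /bipartite_rel /triangles_rel /star_rel /star_triangles.
by move: (val p) (val q) => {}p {}q; case: (ltnP p i) => pi;
  case: (ltnP q i) => qi /=; lia.
Qed.

Lemma adj_H_graph n i (p q : 'I_n) : adj (H_graph n i) p q = adj (F_graph n i
  0) p q.
Proof.
rewrite !adj_graph_of_rel /star_rel.
by rewrite !ltn0 !andbF !orbF.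
Qed.

Lemma isomorphic_H_graph (T : finType) (G : sgraph T) n i :
  isomorphic G (H_graph n i) <-> isomorphic G (F_graph n i 0).
Proof.
by split=> -[f bij_f hf]; exists f => // x y; rewrite -hf adj_H_graph.
Qed.

Definition star_triangles_arcs j m : nat :=
  \sum_(p < m) \sum_(q < m) star_triangles j p q.

Lemma star_triangles_arcsS j m : star_triangles_arcs j m.+1 =
  star_triangles_arcs j m + 2 * \sum_(q < m) star_triangles j m q.
Proof.
rewrite /star_triangles_arcs big_ord_recr /= [X in _ + X]big_ord_recr /=.
under eq_bigr do rewrite big_ord_recr /=.
rewrite big_split /= {4}/star_triangles eqxx /= addn0.
rewrite [X in _ + X + _](eq_bigr (fun q : 'I_m => star_triangles j m q : nat)).
  by lia.
by move=> p _; rewrite star_trianglesC.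
Qed.

Lemma star_triangles_arcs_star j : star_triangles_arcs j j = 2 * j.-1.
Proof.
case: j => [|j]; rewrite /star_triangles_arcs ?big_ord0 //.
have center : \sum_(q < j.+1) star_triangles j.+1 0 q = j.
  rewrite big_ord_recl {1}/star_triangles eqxx add0n (eq_bigr (fun=> 1))
    ?sum1_card ?card_ord //.
  by move=> q _; rewrite /star_triangles /= /bump /= add1n ltnS ltn_ord.
have leaf p : p < j -> \sum_(q < j.+1) star_triangles j.+1 p.+1 q = 1.
  move=> ltpj; rewrite big_ord_recl big1 ?addn0 => [|q _].
    by rewrite /star_triangles /= !ltnS ltpj andbF.
  rewrite /star_triangles /= /bump /= add1n; have := ltn_ord q; lia.
rewrite big_ord_recl center (eq_bigr (fun=> 1)) => [|p _].
  by rewrite sum1_card card_ord mul2n addnn.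
exact: leaf.
Qed.

Lemma star_triangles_arcsE j i : j <= i -> 3 %| i - j ->
  star_triangles_arcs j i + 2 * (0 < j) = 2 * i.
Proof.
move=> leji /dvdnP[t Dt]; have {leji Dt}-> : i = j + 3 * t by lia.
elim: t => [|t IHt].
  by rewrite muln0 addn0 star_triangles_arcs_star; case: j => //= j; lia.
have -> : j + 3 * t.+1 = (j + 3 * t).+3 by lia.
set m := j + 3 * t in IHt *.
have lejm : j <= m by rewrite leq_addr.
have dvd3 : 3 %| m - j by rewrite /m addKn dvdn_mulr.
have low r : r < 3 -> \sum_(q < m) star_triangles j (m + r) q = 0.
  move=> ltr3; apply: big1 => q _.
  by rewrite star_trianglesC (star_triangles_sep lejm) // ltn_ord leq_addr.
have blk := star_triangles_block lejm dvd3.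
have [blk0 low0] := (blk 1 0 isT isT, low 0 isT).
have [blk1 blk2] := (blk 2 0 isT isT, blk 2 1 isT isT).
move: (low 1 isT) (low 2 isT) blk0 low0 blk1 blk2.
rewrite !addn0 addn1 addn2 => low1 low2 blk0 low0 blk1 blk2.
rewrite !star_triangles_arcsS !big_ord_recr /= low0 low1 low2 blk0 blk1 blk2.
by move: IHt; clear; lia.
Qed.

Lemma star_triangles_P4_free j p q r s : uniq [:: p; q; r; s] ->
  star_triangles j p q -> star_triangles j q r -> star_triangles j r s -> False.
Proof.
rewrite /= !inE !negb_or andbT => /and3P[/and3P[npq npr nps] /andP[nqr nqs]
  nrs].
rewrite /star_triangles => /andP[_ pq] /andP[_ qr] /andP[_ rs].
have [ltqj|lejq] := ltnP q j.
  have ltrj : r < j by lia.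
  by lia.
have lejp : j <= p by lia.
have lejr : j <= r by lia.
have lejs : j <= s by lia.
by lia.
Qed.

Section FGraph.

Variables (n i j : nat).
Hypotheses (leji : j <= i) (lein : i <= n) (dvd3 : 3 %| i - j).

Let e := adj (F_graph n i j).
Let X := [set p : 'I_n | p < i].

Lemma F_graph_P6sq_free : P6sq_free e.
Proof.
apply: (@join_P6sq_free _ _ X); first exact: adj_sym.
  move=> p q r s; rewrite !inE => Xp Xq Xr Xs U.
  rewrite /e !adj_F_graph // Xp Xq Xr Xs /=.
  by apply: star_triangles_P4_free; rewrite -[X in uniq X]/(map val [:: p; q;
    r; s]) map_inj_uniq //; apply: val_inj.
by move=> p q; rewrite !inE /e adj_F_graph // => /negPf-> /negPf->.
Qed.

Lemma F_graph_card_edges : #|edges (F_graph n i j)| + (0 < j) = i * (n - i) + i.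
Proof.
apply/eqP; rewrite -(eqn_pmul2l (m := 2)) // mulnDr -arcs_edges; apply/eqP.
have cardX : #|X| = i.
  rewrite -sum1_card (eq_bigl (fun p : 'I_n => p < i)) => [|p];
    last by rewrite inE.
  by rewrite (big_ord_narrow lein) sum1_card card_ord.
have esym : symmetric e by apply: adj_sym.
rewrite (@arcs_split _ _ esym _ X) ?subsetT // setTD.
rewrite (arcs_indep (D := ~: X)); last first.
  by move=> p q; rewrite !inE /e adj_F_graph // => /negPf-> /negPf->.
have -> : arcs e X X = star_triangles_arcs j i.
  rewrite /arcs /star_triangles_arcs.
  rewrite (eq_bigl (fun p : 'I_n => p < i)) => [|p]; last by rewrite inE.
  rewrite (big_ord_narrow lein); apply: eq_bigr => p _.
  rewrite (eq_bigl (fun p : 'I_n => p < i)) => [|q]; last by rewrite inE.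
  rewrite (big_ord_narrow lein); apply: eq_bigr => q _.
  by rewrite /e adj_F_graph //= !ltn_ord.
have -> : arcs e (~: X) X = i * (n - i).
  have <- : #|~: X| = n - i by rewrite cardsCs setCK card_ord cardX.
  rewrite mulnC /arcs -sum_nat_const; apply: eq_bigr => p; rewrite inE => Xp.
  rewrite -[RHS]cardX -sum1_card; apply: eq_bigr => q; move: Xp.
  by rewrite /e adj_F_graph // !inE => /negPf-> ->.
have := star_triangles_arcsE leji dvd3; clear; lia.
Qed.

End FGraph.

Lemma balanced_product a d i m : d <= 1 -> i + m = a + (a + d) ->
  exists t, i * m + t * (t + d) = a * (a + d) /\
    ((a = i + t /\ m = a + d + t) \/ (i = a + d + t /\ a = m + t)).
Proof.
move=> led1 sum; have [leia|ltai] := leqP i a.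
  have Da : a = i + (a - i) by rewrite subnKC.
  exists (a - i); move: (a - i) Da => t Da; subst a.
  have -> : m = i + t + d + t by lia.
  by split; [lia | left].
have Di : i = a + d + (i - a - d) by lia.
exists (i - a - d); move: (i - a - d) Di => t Di; subst i.
have -> : a = m + t by lia.
by split; [lia | right].
Qed.

(* The maximum of i (n - i) + i exceeds exval n by exactly the defect, which
   leaves room for a star component, having one edge less than vertices. *)
Definition exval_defect (n : nat) : nat := 0 < n %% 6 < 4.

Lemma exval_product n : exval n + exval_defect n = n.+1./2 * (n.+1./2 + odd
  n.+1).
Proof.
rewrite /exval_defect; case: (mod6P n) => k r lt_r6.
have -> : (6 * k + r) %% 6 = r by lia.
rewrite exvalE //; have -> : (6 * k + r).+1./2 = 3 * k + r.+1./2 by lia.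
have -> : odd (6 * k + r).+1 = odd r.+1 by lia.
by move: r lt_r6 => [|[|[|[|[|[|//]]]]]] _ /=; lia.
Qed.

Definition exval_shape (n i j : nat) : bool :=
  [&& j <= i, i <= n, 3 %| i - j & i * (n - i) + i == exval n + (0 < j)].

Lemma join_size_bound n i : i <= n -> i * (n - i) + i <= exval n + 1.
Proof.
move=> lein; have [||t [Dt _]] := @balanced_product n.+1./2 (odd n.+1) i (n - i
  + 1).
- by case: odd.
- by move: lein; clear; lia.
have := exval_product n; rewrite -Dt.
have : exval_defect n <= 1 by rewrite /exval_defect; case: (_ < _ < _).
by rewrite mulnDr muln1; move: (i * _) (t * _); clear; lia.
Qed.

Definition exval_indices (n i j : nat) : bool :=
  match n %% 6 with
  | 0 => (j == 0) && (i == n./2)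
  | 1 => i == if 0 < j then uphalf n else n./2
  | 2 => (0 < j) && ((i == n./2) || (i == n./2 + 1))
  | 3 => i == if 0 < j then uphalf n else uphalf n + 1
  | 4 => (j == 0) && (i == n./2 + 1)
  | _ => (j == 0) && (i == uphalf n)
  end.

Lemma exval_shapeE n i j :
  exval_shape n i j = [&& j <= i, 3 %| i - j & exval_indices n i j].
Proof.
have -> : exval_shape n i j =
    [&& j <= i, 3 %| i - j & (i <= n) && (i * (n - i) + i == exval n + (0 <
      j))].
  by rewrite /exval_shape; case: (j <= i) => //=; case: (i <= n);
    rewrite ?andbF.
case: (boolP (j <= i)) => //= leji; case: (boolP (3 %| i - j)) => //= dvd3.
apply/andP/idP => [[lein /eqP shape]|].
  have [||t [Dt Di]] := @balanced_product n.+1./2 (odd n.+1) i (n - i + 1).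
  - by case: odd.
  - by move: lein; clear; lia.
  have := exval_product n; rewrite -Dt mulnDr muln1 shape.
  have -> : exval n + (0 < j) + t * (t + odd n.+1) = exval n + ((0 < j) + t *
    (t + odd n.+1)).
    by rewrite addnA.
  move/addnI; rewrite /exval_defect /exval_indices => def_t.
  have le_t1 : t <= 1.
    have : t * t <= 1 by move: def_t; case: (0 < _ < _); lia.
    by case: t {Dt Di def_t} => [|[|t]] //.
  case: t le_t1 {Dt shape} def_t Di => [|[|//]] _; rewrite ?mul0n ?mul1n;
    case: (mod6P n) lein => k r lt_r6 lein;
      have -> : (6 * k + r) %% 6 = r by lia.
  1,2: by move: r lt_r6 lein => [|[|[|[|[|[|//]]]]]] _ /= lein def_t Di;
    case: j leji dvd3 def_t => [|j] /=; lia.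
rewrite /exval_indices; case: (mod6P n) => k r lt_r6;
  have -> : (6 * k + r) %% 6 = r by lia.
have fin a b : i = 3 * k + a -> a + b = r ->
    (3 * k + a) * (3 * k + b) + (3 * k + a) = exval (6 * k + r) + (0 < j) ->
    i <= 6 * k + r /\ i * (6 * k + r - i) + i == exval (6 * k + r) + (0 < j).
  move=> -> <- <-; have -> : 6 * k + (a + b) - (3 * k + a) = 3 * k + b by lia.
  by split=> //; lia.
move: fin; rewrite exvalE // {leji dvd3};
  move: r lt_r6 => [|[|[|[|[|[|//]]]]]] _ /= fin.
- by case/andP=> /eqP Dj /eqP Di; apply: (fin 0 0); rewrite ?Dj; lia.
- case: (posnP j) fin => _ fin /eqP Di; [apply: (fin 0 1) | apply: (fin 1 0)];
  lia.
- case/andP=> j_gt0; move: fin; rewrite j_gt0 => fin.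
  by case/orP=> /eqP Di; [apply: (fin 1 1) | apply: (fin 2 0)]; lia.
- case: (posnP j) fin => _ fin /eqP Di; [apply: (fin 3 0) | apply: (fin 2 1)];
  lia.
- by case/andP=> /eqP Dj /eqP Di; apply: (fin 3 1); rewrite ?Dj; lia.
- by case/andP=> /eqP Dj /eqP Di; apply: (fin 3 2); rewrite ?Dj; lia.
Qed.

Lemma exval_shape_exists n : exists i j, exval_shape n i j.
Proof.
pose i := if n %% 6 == 4 then n./2 + 1 else if n %% 6 == 2 then n./2 else
  uphalf n.
exists i, (if 0 < n %% 6 < 4 then i else 0).
rewrite exval_shapeE /exval_indices {}/i; case: (mod6P n) => k r lt_r6.
have -> : (6 * k + r) %% 6 = r by lia.
by move: r lt_r6 => [|[|[|[|[|[|//]]]]]] _ /=; do ?case: ifP; lia.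
Qed.

Lemma P6sq_free_card_edges (T : finType) (G : sgraph T) : 5 < #|T| ->
  P6sq_free (adj G) -> #|edges G| <= exval #|T|.
Proof.
move=> T_gt5 P6free; have := P6sq_free_bound (@adj_sym _ G) (@adj_irr _ G)
  P6free (S := setT).
by rewrite cardsT arcs_edges => /(_ T_gt5)[]; rewrite leq_mul2l.
Qed.

Lemma turan_square_path6 n : 5 < n -> turan_number n (square_path 6) = exval n.
Proof.
move=> n_gt5; apply/eqP; rewrite eqn_leq; apply/andP; split.
  apply/bigmax_leqP=> G /has_square_path6 P6free.
  by have := P6sq_free_card_edges _ P6free; rewrite card_ord; apply.
have [i [j /and4P[leji lein dvd3 /eqP shape]]] := exval_shape_exists n.
have := F_graph_card_edges leji lein dvd3; rewrite shape => /addIn <-.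
apply: (leq_bigmax_cond (F := fun G : sgraph 'I_n => #|edges G|)).
by apply/has_square_path6; apply: F_graph_P6sq_free.
Qed.

Lemma join_isomorphic (T : finType) (G : sgraph T) (X : {set T}) j (s : seq T)
  (x0 : T) :
  uniq s -> s =i X -> j <= size s ->
  (forall p q, p < size s -> q < size s ->
    adj G (nth x0 s p) (nth x0 s q) = star_triangles j p q) ->
  {in ~: X &, forall x y, ~~ adj G x y} ->
  {in ~: X & X, forall x y, adj G x y} ->
  isomorphic G (F_graph #|T| (size s) j).
Proof.
move=> Us sX lejs pat Y0 YX; pose t := s ++ enum (~: X).
have Ut : uniq t.
  rewrite cat_uniq Us enum_uniq andbT; apply/hasPn=> x.
  by rewrite mem_enum inE /= sX.
have tT x : x \in t by rewrite mem_cat mem_enum inE sX orbN.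
have szt : size t = #|T|.
  by rewrite -(card_uniqP Ut); apply: eq_card => x; rewrite tT.
have ltt x : index x t < #|T| by rewrite -szt index_mem.
exists (fun x => Ordinal (ltt x)).
  apply: inj_card_bij; last by rewrite card_ord.
  by move=> x y /(congr1 val)/= xy; rewrite -(nth_index x0 (tT x)) xy nth_index.
have idx x : (index x t < size s) = (x \in X).
  rewrite index_cat sX; case: (boolP (x \in X)) => Xx.
    by rewrite index_mem sX.
  by rewrite ltnNge leq_addr.
move=> x y; rewrite adj_F_graph //= !idx.
case: (boolP (x \in X)) => Xx; case: (boolP (y \in X)) => Xy /=.
- by rewrite !index_cat !sX Xx Xy -pat ?index_mem ?sX // !nth_index ?sX.
- by rewrite adj_sym YX ?inE.
- by rewrite YX ?inE.
- by apply/esym/negbTE; apply: Y0; rewrite inE.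
Qed.

Lemma extremal_square_path6P (T : finType) (G : sgraph T) : 5 < #|T| ->
  extremal (square_path 6) G <->
  exists i j, exval_shape #|T| i j /\ isomorphic G (F_graph #|T| i j).
Proof.
move=> T_gt5; split; last first.
  case=> i [j [/and4P[leji lein dvd3 /eqP shape] isoG]]; split.
    by apply/has_square_path6;
      apply: isomorphic_P6sq_free isoG (F_graph_P6sq_free leji).
  rewrite turan_square_path6 // (isomorphic_card_edges isoG).
  by have := F_graph_card_edges leji lein dvd3; rewrite shape => /addIn.
case=> /has_square_path6 P6free; rewrite turan_square_path6 // => edgesG.
pose e := adj G; have esym : symmetric e := @adj_sym _ G.
have eirr : irreflexive e := @adj_irr _ G.
have arcsT : arcs e setT setT = 2 * exval #|T| by rewrite arcs_edges edgesG.
have /card_gt0P[x0 _] : 0 < #|T| by apply: leq_trans T_gt5.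
have [|_] := P6sq_free_bound esym eirr P6free (S := setT); rewrite cardsT //.
case/(_ arcsT)=> X [_ X4]; rewrite setTD => Y0.
have leXT : #|X| <= #|T| := max_card _.
have cardY : #|~: X| = #|T| - #|X| by rewrite cardsCs setCK.
have arcsYX : arcs e (~: X) X <= #|X| * (#|T| - #|X|).
  by rewrite -cardY; apply: sum_leq_card => y _; apply: deg_leq.
have := arcs_split esym (subsetT X);
  rewrite setTD (arcs_indep Y0) addn0 arcsT => arcsE.
have [few|[j [s [Us sX lejs dvd3 [arcsX pat]]]]] := P4_free_classify esym eirr
  x0 X4.
  exfalso; have := join_size_bound leXT; move: arcsE few arcsYX; clear.
  by move: (#|X| * _) => p; lia.
have szs : size s = #|X| by rewrite -(card_uniqP Us); apply: eq_card.
have lesT : size s <= #|T| by rewrite szs.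
have leF : size s * (#|T| - size s) + size s <= exval #|T| + (0 < j).
  rewrite -(F_graph_card_edges lejs lesT dvd3) leq_add2r.
  have := @P6sq_free_card_edges _ (F_graph #|T| (size s) j); rewrite card_ord;
    apply=> //.
  exact: F_graph_P6sq_free.
have [shape full] : size s * (#|T| - size s) + size s = exval #|T| + (0 < j)
    /\ arcs e (~: X) X = #|X| * #|~: X|.
  rewrite cardY; move: leF arcsE arcsX arcsYX; rewrite szs; clear.
  by move: (#|X| * _) => p; lia.
exists (size s), j; split;
  first by rewrite /exval_shape lejs lesT dvd3 shape eqxx.
have degX y : y \in ~: X -> deg e y X = #|X|.
  move: y; apply: (sum_eq_card (F := fun z => deg e z X)) => [z _|].
    exact: deg_leq.
  by rewrite -full.
by apply: join_isomorphic Us sX lejs pat Y0 _ => y x Yy; apply: deg_full;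
  rewrite degX.
Qed.

Theorem theorem8 (n : nat) (n_ge6 : 6 <= n) (T : finType) (cardT : #|T| = n)
    (G : sgraph T) :
  (n = 1 %[mod 6] ->
     (extremal (square_path 6) G <->
        isomorphic_to_some_F n (uphalf n) G \/ isomorphic G (H_graph n n./2))) /\
  (n = 2 %[mod 6] ->
     (extremal (square_path 6) G <->
        isomorphic_to_some_F n n./2 G \/ isomorphic_to_some_F n (n./2 + 1) G)) /\
  (n = 3 %[mod 6] ->
     (extremal (square_path 6) G <->
        isomorphic_to_some_F n (uphalf n) G \/
        isomorphic G (H_graph n (uphalf n + 1)))) /\
  (n = 0 %[mod 6] ->
     (extremal (square_path 6) G <-> isomorphic G (H_graph n n./2))) /\
  (n = 4 %[mod 6] ->
     (extremal (square_path 6) G <-> isomorphic G (H_graph n (n./2 + 1)))) /\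
  (n = 5 %[mod 6] ->
     (extremal (square_path 6) G <-> isomorphic G (H_graph n (uphalf n)))).
Proof.
have := @extremal_square_path6P T G; rewrite cardT => /(_ n_ge6) extP.
have introF i : (forall j, 0 < j -> exval_indices n i j) ->
  isomorphic_to_some_F n i G ->
    extremal (square_path 6) G.
  move=> idx [j [/andP[j_gt0 leji] dvd3 isoG]]; apply/extP; exists i, j.
  by rewrite exval_shapeE leji dvd3 idx.
have introH i : 3 %| i -> exval_indices n i 0 -> isomorphic G (H_graph n i) ->
    extremal (square_path 6) G.
  move=> dvd3 idx /isomorphic_H_graph isoG; apply/extP; exists i, 0.
  by rewrite exval_shapeE subn0 dvd3 idx.
have elimF : extremal (square_path 6) G -> exists i j, [/\ exval_indices n i j,
    0 < j -> isomorphic_to_some_F n i G & j = 0 -> isomorphic G (H_graph n i)].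
  case/extP=> i [j []]; rewrite exval_shapeE => /and3P[leji dvd3 idx] isoG.
  exists i, j; split=> // [j_gt0|j0]; first by exists j; rewrite j_gt0.
  by apply/isomorphic_H_graph; rewrite -j0.
split=> [nmod|].
  have {}nmod : n %% 6 = 1 by [].
  rewrite /exval_indices nmod /= in introF introH elimF.
  split=> [/elimF[i [j [idx F0 H0]]]|].
    by case: (posnP j) idx => [/H0 isoG|/F0 isoG] /eqP <-; [right | left].
  by case; [apply: introF => j -> | apply: introH; rewrite ?eqxx //; lia].
split=> [nmod|].
  have {}nmod : n %% 6 = 2 by [].
  rewrite /exval_indices nmod /= in introF introH elimF.
  split=> [/elimF[i [j [idx F0 H0]]]|].
    by case/andP: idx => /F0 isoG /orP[]/eqP <-; [left | right].
  by case; apply: introF => j ->; rewrite eqxx ?orbT.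
split=> [nmod|].
  have {}nmod : n %% 6 = 3 by [].
  rewrite /exval_indices nmod /= in introF introH elimF.
  split=> [/elimF[i [j [idx F0 H0]]]|].
    by case: (posnP j) idx => [/H0 isoG|/F0 isoG] /eqP <-; [right | left].
  by case; [apply: introF => j -> | apply: introH; rewrite ?eqxx //; lia].
split=> [nmod|].
  have {}nmod : n %% 6 = 0 by [].
  rewrite /exval_indices nmod /= in introF introH elimF.
  split=> [/elimF[i [j [idx F0 H0]]]|].
    by case/andP: idx => /eqP/H0 isoG /eqP <-.
  by apply: introH; rewrite ?eqxx //; lia.
split=> [nmod|].
  have {}nmod : n %% 6 = 4 by [].
  rewrite /exval_indices nmod /= in introF introH elimF.
  split=> [/elimF[i [j [idx F0 H0]]]|].
    by case/andP: idx => /eqP/H0 isoG /eqP <-.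
  by apply: introH; rewrite ?eqxx //; lia.
move=> nmod.
have {}nmod : n %% 6 = 5 by [].
rewrite /exval_indices nmod /= in introF introH elimF.
split=> [/elimF[i [j [idx F0 H0]]]|].
  by case/andP: idx => /eqP/H0 isoG /eqP <-.
by apply: introH; rewrite ?eqxx //; lia.
Qed.
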